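(* Let $\omega\in(0,1)$ and let $\boldsymbol a=\{a_j\}_{j\ge1}$, $\boldsymbol b=\{b_j\}_{j\ge1}$ be real sequences with $1\le a_1\le a_2\le a_3\le\cdots$ and $b_j\ge1$ for all $j$. Consider $L_2$-approximation over the Korobov spaces $H(K_{s,\boldsymbol a,\boldsymbol b})$, $s\in\mathbb N$. Put $$B(s):=\sum_{j=1}^s\frac1{b_j},\qquad B:=\sum_{j=1}^\infty\frac1{b_j}\in(0,\infty],\qquad \alpha^*:=\liminf_{j\to\infty}\frac{\log a_j}{j}\in[0,\infty].$$ Then the following statements hold for each of the two information classes $\Lambda=\Lambda^{\rm all}$ and $\Lambda=\Lambda^{\rm std}$. 1. EXP holds for arbitrary $\boldsymbol a$ and $\boldsymbol b$, and $p^*(s)=1/B(s)$ for all $s\in\mathbb N$. Consequently, WT $\Leftrightarrow$ WT+EXP, PT $\Leftrightarrow$ PT+EXP, SPT $\Leftrightarrow$ SPT+EXP. 2. UEXP holds if and only if $B<\infty$ (with $\boldsymbol a$ arbitrary). If $B<\infty$, then $p^*=1/B$, and WT $\Leftrightarrow$ WT+UEXP, PT $\Leftrightarrow$ PT+UEXP, SPT $\Leftrightarrow$ SPT+UEXP. 3. PT (and hence also SPT) implies UEXP; i.e. PT $\Leftrightarrow$ PT+UEXP and SPT $\Leftrightarrow$ SPT+UEXP. 4. WT holds if and only if $\lim_{j\to\infty}a_j=\infty$. WT+UEXP holds if and only if $B<\infty$ and $\lim_{j\to\infty}a_j=\infty$. 5. The following are equivalent: PT, PT+EXP, PT+UEXP,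 SPT, SPT+EXP, SPT+UEXP. 6. SPT+UEXP holds if and only if $B<\infty$ and $\alpha^*>0$. In this case the exponent $\tau^*$ of SPT satisfies $$\max\left(B,\frac{\log 3}{\alpha^*}\right)\le\tau^*\le B+\frac{\log 3}{\alpha^*},$$ where $(\log 3)/\alpha^*:=0$ if $\alpha^*=\infty$. In particular, if $\alpha^*=\infty$ then $\tau^*=B$.
   Context: $\mathbb N=\{1,2,\dots\}$; $\log$ is the natural logarithm. **Korobov space.** Fix $\omega\in(0,1)$ and sequences $\boldsymbol a,\boldsymbol b$ as in the claim. For $s\in\mathbb N$ and $\boldsymbol h=(h_1,\dots,h_s)\in\mathbb Z^s$ put $\omega_{\boldsymbol h}=\omega^{\sum_{j=1}^s a_j|h_j|^{b_j}}$ (with $0^{b}=0$). $H(K_{s,\boldsymbol a,\boldsymbol b})$ is the reproducing kernel Hilbert space of complex-valued one-periodic functions on $[0,1]^s$ with kernel $K_{s,\boldsymbol a,\boldsymbol b}(\boldsymbol x,\boldsymbol y)=\sum_{\boldsymbol h\in\mathbb Z^s}\omega_{\boldsymbol h}\exp(2\pi \mathrm i\,\boldsymbol h\cdot(\boldsymbol x-\boldsymbol y))$. Equivalently, it consists of the functions $f(\boldsymbol x)=\sum_{\boldsymbol h\in\mathbb Z^s}\widehat f(\boldsymbol h)\exp(2\pi\mathrm i\,\boldsymbol h\cdot\boldsymbol x)$ with $\|f\|_{H(K_{s,\boldsymbol a,\boldsymbol b})}^2=\sum_{\boldsymbol h\in\mathbb Z^s}|\widehat f(\boldsymbol h)|^2\omega_{\boldsymbol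 h}^{-1}<\infty$, where $\widehat f(\boldsymbol h)=\int_{[0,1]^s}f(\boldsymbol x)\exp(-2\pi\mathrm i\,\boldsymbol h\cdot\boldsymbol x)\,d\boldsymbol x$. **$L_2$-approximation.** One approximates the embedding $H(K_{s,\boldsymbol a,\boldsymbol b})\to L_2([0,1]^s)$, $f\mapsto f$, by linear algorithms $A_{n,s}(f)=\sum_{k=1}^n\alpha_kL_k(f)$ with $\alpha_k\in L_2([0,1]^s)$ and $L_k\in\Lambda$. Here $\Lambda$ is either $\Lambda^{\rm all}$, the class of all continuous linear functionals on $H(K_{s,\boldsymbol a,\boldsymbol b})$, or $\Lambda^{\rm std}$, the class of function evaluations $f\mapsto f(\boldsymbol x_k)$, $\boldsymbol x_k\in[0,1]^s$. For $n=0$ one takes $A_{0,s}=0$. The $n$th minimal worst-case error is $$e^{\Lambda}(n,s)=\inf_{A_{n,s}}\ \sup_{\|f\|_{H(K_{s,\boldsymbol a,\boldsymbol b})}\le1}\|f-A_{n,s}(f)\|_{L_2([0,1]^s)},$$ the infimum being over all linear algorithms using $n$ functionals from $\Lambda$. The information complexity is $n^{\Lambda}(\varepsilon,s)=\min\{n:\ e^{\Lambda}(n,s)\le\varepsilon\}$ for $\varepsilon\in(0,1)$, $s\in\mathbb N$. **Convergence notions** (for a given $\Lambda$). - EXP (exponential convergence): there exist $q\in(0,1)$ and functions $p,C,C_1:\mathbb N\to(0,\infty)$ such that $$(\ast)\qquad e^{\Lambda}(n,s)\le C(s)\,q^{(n/C_1(s))^{p(s)}}\quad\text{for all } n,s\in\mathbb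 N.$$ $p^*(s)$ denotes the supremum of all $p(s)$ satisfying $(\ast)$ (for some $q$, $C$, $C_1$). - UEXP (uniform exponential convergence): $(\ast)$ holds with a constant function $p(s)=p>0$ for all $s$; $p^*$ denotes the supremum of all such constants $p$. **Tractability notions** (for a given $\Lambda$). - WT (weak tractability): $\lim_{s+\log\varepsilon^{-1}\to\infty}\dfrac{\log n^{\Lambda}(\varepsilon,s)}{s+\log\varepsilon^{-1}}=0$ (with $\log 0:=0$). - PT (polynomial tractability): there are $c,\tau_1,\tau_2\ge0$ with $n^{\Lambda}(\varepsilon,s)\le c\,s^{\tau_1}(1+\log\varepsilon^{-1})^{\tau_2}$ for all $s\in\mathbb N$, $\varepsilon\in(0,1)$. - SPT (strong polynomial tractability): there are $c,\tau\ge0$ with $n^{\Lambda}(\varepsilon,s)\le c\,(1+\log\varepsilon^{-1})^{\tau}$ for all $s\in\mathbb N$, $\varepsilon\in(0,1)$. The exponent $\tau^*$ of SPT is the infimum of all such $\tau$. ''X+EXP'' (resp. ''X+UEXP'') means that both X and EXP (resp. UEXP) hold. *)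

(* Defs.v *)
From HB Require Import structures.
From mathcomp Require Import all_boot all_order all_algebra.
From mathcomp Require Import finmap complex.
From mathcomp Require Import all_classical all_reals all_analysis.

Set Implicit Arguments.
Unset Strict Implicit.
Unset Printing Implicit Defensive.

Import Order.TTheory GRing.Theory Num.Theory.
Import numFieldNormedType.Exports.

Local Open Scope classical_set_scope.
Local Open Scope ring_scope.
Local Open Scope complex_scope.

(* Sequences a, b, and functions of the dimension s, are indexed from 1: they
   are functions on nat whose value at 0 is never used.  Coordinate j : 'I_s,
   numbered from 0, therefore goes with a j.+1 and b j.+1.  *)

Notation point R s := (s.-tuple (measurableTypeR R)).

Section UnitCube.
Variable R : realType.

Definition point_cons (s : nat) (p : measurableTypeR R * point R s) :
  point R s.+1 := [tuple of p.1 :: p.2].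

Lemma measurable_point_cons s : measurable_fun setT (@point_cons s).
Proof. exact: measurable_cons. Qed.

HB.instance Definition _ s :=
  isMeasurableFun.Build _ _ _ _ (@point_cons s) (@measurable_point_cons s).

(* Lebesgue measure on [0,1]^s, seen as a probability measure on R^s: the
   s-fold product of the uniform distribution on [0,1]. *)
Fixpoint cube_prob (s : nat) : probability (point R s) R :=
  match s with
  | 0 => \d_ [tuple]
  | s'.+1 =>
      distribution (uniform_prob (@ltr01 R) \x cube_prob s')%E (@point_cons s')
  end.

Definition unit_cube (s : nat) : set (point R s) :=
  [set x : point R s | forall j, 0 <= (tnth x j : R) <= 1].

Definition cabs (z : R[i]) : R := Normc.normc z.

Definition cexpi (t : R) : R[i] := cos t +i* sin t.

Definition cintegral s (f : point R s -> R[i]) : R[i] :=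
  Complex (\int[cube_prob s]_x complex.Re (f x))
          (\int[cube_prob s]_x complex.Im (f x)).

Definition L2norm s (f : point R s -> R[i]) : \bar R :=
  Lnorm (cube_prob s) 2%:E (fun x => (cabs (f x))%:E).

(* Since the measure is concentrated on the cube, asking for measurability on
   the whole of R^s only amounts to choosing a representative. *)
Definition in_L2 s (f : point R s -> R[i]) : Prop :=
  [/\ measurable_fun setT (fun x => complex.Re (f x) : measurableTypeR R),
      measurable_fun setT (fun x => complex.Im (f x) : measurableTypeR R)
    & (L2norm f < +oo)%E].

(* Unconditional convergence of a countable family to its sum. *)
Definition has_sum (I : choiceType) (u : I -> R[i]) (z : R[i]) : Prop :=
  forall e : R, 0 < e -> exists A : {fset I}, forall B : {fset I},
    (A `<=` B)%fset -> cabs (\sum_(i <- enum_fset B) u i - z) < e.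

End UnitCube.

Section Korobov.
Variables (R : realType) (omega : R) (a b : nat -> R) (s : nat).
Implicit Types (f g : point R s -> R[i]) (h : s.-tuple int).

Definition dotp h (x : point R s) : R :=
  \sum_(j < s) (tnth h j)%:~R * (tnth x j : R).

Definition fourier f h : R[i] :=
  cintegral (fun x => f x * cexpi (- (2 * pi * dotp h x))).

Definition omega_h h : R :=
  omega `^ (\sum_(j < s) a j.+1 * ((`|tnth h j|%N)%:R `^ b j.+1)).

Definition Hnorm f : \bar R :=
  sqrte (\esum_(h in [set: s.-tuple int])
           (cabs (fourier f h) ^+ 2 * (omega_h h)^-1)%:E).

(* The functions are the one-periodic extensions to R^s: the Fourier series is
   required to represent f at every point of R^s. *)
Definition in_H f : Prop :=
  [/\ (cube_prob R s).-integrable setT (fun x => (complex.Re (f x))%:E),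
      (cube_prob R s).-integrable setT (fun x => (complex.Im (f x))%:E),
      forall x, has_sum (fun h => fourier f h * cexpi (2 * pi * dotp h x)) (f x)
    & (Hnorm f < +oo)%E].

(* A functional on H is a map defined on all functions R^s -> C of which only
   the values on H matter. *)
Definition functional := (point R s -> R[i]) -> R[i].

Definition linear_on_H (L : functional) : Prop :=
  forall (c : R[i]) f g, in_H f -> in_H g ->
    L (fun x => c * f x + g x) = c * L f + L g.

Definition continuous_on_H (L : functional) : Prop :=
  forall f, in_H f -> forall e : R, 0 < e -> exists2 d : R, 0 < d &
    forall g, in_H g -> (Hnorm (fun x => (g x - f x)%R) < d%:E)%E ->
      cabs (L g - L f) < e.

End Korobov.

Inductive info_class := Lambda_all | Lambda_std.

Section Approximation.
Variables (R : realType) (omega : R) (a b : nat -> R) (Lam : info_class).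

Definition admissible s (L : functional R s) : Prop :=
  match Lam with
  | Lambda_all => linear_on_H omega a b L /\ continuous_on_H omega a b L
  | Lambda_std => exists2 x, unit_cube x &
                    forall f, in_H omega a b f -> L f = f x
  end.

Definition algorithm n s (alpha : 'I_n -> point R s -> R[i])
    (L : 'I_n -> functional R s) (f : point R s -> R[i]) : point R s -> R[i] :=
  fun x => \sum_(k < n) alpha k x * L k f.

Definition worst_case_error s
    (A : (point R s -> R[i]) -> point R s -> R[i]) : \bar R :=
  ereal_sup [set L2norm (fun x => f x - A f x) |
             f in [set f | in_H omega a b f /\ (Hnorm omega a b f <= 1)%E]].

(* For n = 0 the only algorithm is the zero algorithm (empty sum). *)
Definition min_error (n s : nat) : \bar R :=
  ereal_inf [set worst_case_error (algorithm p.1 p.2) |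
             p in [set p : ('I_n -> point R s -> R[i]) * ('I_n -> functional R s)
                  | (forall k, in_L2 (p.1 k)) /\ (forall k, admissible (p.2 k))]].

(* An infimum of a set of natural numbers, hence its minimum; it would be +oo
   if no n achieved the error eps. *)
Definition info_complexity (eps : R) (s : nat) : \bar R :=
  ereal_inf [set n%:R%:E | n in [set n : nat | (min_error n s <= eps%:E)%E]].

(* The bound e(n,s) <= C(s) q^((n/C1(s))^p(s)). *)
Definition exp_bound (q : R) (p C C1 : nat -> R) : Prop :=
  [/\ 0 < q < 1,
      forall s, (0 < s)%N -> [/\ 0 < p s, 0 < C s & 0 < C1 s]
    & forall n s, (0 < n)%N -> (0 < s)%N ->
        (min_error n s <= (C s * q `^ ((n%:R / C1 s) `^ p s))%:E)%E].

Definition EXP : Prop := exists q p C C1, exp_bound q p C C1.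

Definition p_star (s : nat) : \bar R :=
  ereal_sup [set (p s)%:E |
             p in [set p | exists q C C1, exp_bound q p C C1]].

Definition uexp_exponent (p : R) : Prop :=
  0 < p /\ exists q C C1, exp_bound q (fun=> p) C C1.

Definition UEXP : Prop := exists p, uexp_exponent p.

Definition p_star_unif : \bar R :=
  ereal_sup [set p%:E | p in uexp_exponent].

(* log with log 0 = 0. *)
Definition log0 (x : \bar R) : \bar R := if x == 0%E then 0%E else lne x.

Definition WT : Prop :=
  forall delta : R, 0 < delta -> exists M : R,
    forall (s : nat) (eps : R), (0 < s)%N -> 0 < eps < 1 ->
      M < s%:R + ln eps^-1 ->
      (`| log0 (info_complexity eps s) / (s%:R + ln eps^-1)%:E | < delta%:E)%E.

Definition PT : Prop :=
  exists c tau1 tau2 : R, [/\ 0 <= c, 0 <= tau1, 0 <= tau2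
    & forall (s : nat) (eps : R), (0 < s)%N -> 0 < eps < 1 ->
      (info_complexity eps s
         <= (c * s%:R `^ tau1 * (1 + ln eps^-1) `^ tau2)%:E)%E].

Definition spt_exponent (tau : R) : Prop :=
  0 <= tau /\ exists2 c : R, 0 <= c &
    forall (s : nat) (eps : R), (0 < s)%N -> 0 < eps < 1 ->
      (info_complexity eps s <= (c * (1 + ln eps^-1) `^ tau)%:E)%E.

Definition SPT : Prop := exists tau, spt_exponent tau.

Definition tau_star : \bar R :=
  ereal_inf [set tau%:E | tau in spt_exponent].

End Approximation.

Section WeightQuantities.
Variable R : realType.

Definition Bsum (b : nat -> R) (s : nat) : R := \sum_(1 <= j < s.+1) (b j)^-1.

Definition Btot (b : nat -> R) : \bar R :=
  (\sum_(1 <= j <oo) ((b j)^-1)%:E)%E.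

Definition alpha_star (a : nat -> R) : \bar R :=
  limn_einf (fun j => (ln (a j) / j%:R)%:E).

End WeightQuantities.

(* Main.v *)
(* Write E(h) = sum_j a_j |h_j|^(b_j), so that omega_h = omega^(E(h)).

   Lower bounds.  If n + 1 frequencies satisfy E(h) <= Y, some trigonometric
   polynomial f on these frequencies is annihilated by the n given functionals;
   Parseval for trigonometric polynomials gives ||f||_2 >= omega^(Y/2) ||f||_H,
   so the error is at least omega^(Y/2).  Boxes, with about Y^(B(s))
   frequencies, give p <= 1/B(s) and tau >= B(s); the 3^s frequencies in
   {-1,0,1}^s give tau >= (log 3)/alpha* and the necessity of a_j -> oo.

   Upper bounds, for both classes at once since evaluations are continuous.
   Sample at a finite subgroup of the torus whose characters separate a finite
   set G of frequencies, and replace each f^(h), h in G, by the corresponding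
   discrete Fourier coefficient.  A frequency k is reproduced exactly if it lies
   in G, and otherwise is aliased to at most one element of G, so the error in
   the sup norm, hence in L_2, is at most 2 sum_(k notin G) |f^(k)|.  If E >= X
   outside G, Cauchy-Schwarz bounds this by a constant times
   omega^(X/4) (sum_h omega_h^(1/2))^(1/2).
   A product grid adapted to a box G needs about 3^#{j : a_j <= X} X^(B(s))
   points, which yields the rates.  For weak tractability the box is too large;
   there G = {E <= X}, which has exp(o(s + X)) elements when a_j -> oo, and a
   rank-1 lattice with O(X |G|^2) points separates it. *)

From HB Require Import structures.
From mathcomp Require Import all_boot all_order all_algebra.
From mathcomp Require Import finmap complex ring lra zify.
From mathcomp Require Import all_classical all_reals all_analysis.
From mathcomp Require Import measurable_realfun.
Require Import Defs.

Set Implicit Arguments.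
Unset Strict Implicit.
Unset Printing Implicit Defensive.

Import Order.TTheory GRing.Theory Num.Theory.
Import numFieldNormedType.Exports.

Local Open Scope classical_set_scope.
Local Open Scope ring_scope.
Local Open Scope complex_scope.

(** * Complex exponentials *)

(** Constant factors in the exponent of omega are invisible to p*, tau* and weak tractability, so
    half of each weight can be spent on summability: outside G, omega_k <= omega^(X/2)
    omega_k^(1/2), and the square root in Cauchy-Schwarz leaves omega^(X/4). Hence q = omega^(1/4)
    serves every s, while the dimension enters through C(s), C_1(s) and the sum of the
    omega_h^(1/2), which stays bounded in s once alpha* > 0.

    Statement 6 has a maximum on one side and a sum on the other because the grid pays for its
    powers of 3 and of X at the same time, whereas the box and the cube give two separate lower
    bounds.

    The grid is too large for weak tractability because log(1/eps) of order s already makes X of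
    order s; with B(s) of order s, the logarithm of X^(B(s)) is then about s log X, which is not o(s
    + log(1/eps)).

    A function of the space is known at a point only as the unconditional sum of its Fourier series.
    The estimates are therefore made on finite partial sums, chosen close to f at the finitely many
    points in question. *)

Section ComplexModulus.
Variable R : realType.
Implicit Types (z w : R[i]) (t u : R).

Lemma cabs_sqr z : cabs z ^+ 2 = complex.Re z ^+ 2 + complex.Im z ^+ 2.
Proof. by case: z => x y; rewrite /cabs /= sqr_sqrtr// addr_ge0 ?sqr_ge0. Qed.

Lemma cabs_ge0 z : 0 <= cabs z.
Proof. by case: z => x y; exact: sqrtr_ge0. Qed.

Lemma cabs0 : cabs (0 : R[i]) = 0.
Proof. exact: Normc.normc0. Qed.

Lemma cabs_eq0 z : (cabs z == 0) = (z == 0).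
Proof.
by apply/eqP/eqP => [|->]; [exact: Normc.eq0_normc|exact: cabs0].
Qed.

Lemma cabsM z w : cabs (z * w) = cabs z * cabs w.
Proof. exact: Normc.normcM. Qed.

Lemma cabsD z w : cabs (z + w) <= cabs z + cabs w.
Proof. exact: le_normcD. Qed.

Lemma cabsN z : cabs (- z) = cabs z.
Proof. exact: normcN. Qed.

Lemma cabs_real t : cabs t%:C = `|t|.
Proof. by rewrite /cabs /= expr0n addr0 sqrtr_sqr. Qed.

Lemma cabs_sum (I : Type) (r : seq I) (P : pred I) (F : I -> R[i]) :
  cabs (\sum_(i <- r | P i) F i) <= \sum_(i <- r | P i) cabs (F i).
Proof.
elim/big_rec2 : _ => [|i x y _ h]; first by rewrite cabs0.
by apply: (le_trans (cabsD _ _)); rewrite lerD2l.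
Qed.

Lemma cabs_Re z : `|complex.Re z| <= cabs z.
Proof.
rewrite -[leRHS](ger0_norm (cabs_ge0 z)) -ler_sqr ?nnegrE//.
by rewrite !real_normK ?num_real// cabs_sqr lerDl sqr_ge0.
Qed.

Lemma cabs_Im z : `|complex.Im z| <= cabs z.
Proof.
rewrite -[leRHS](ger0_norm (cabs_ge0 z)) -ler_sqr ?nnegrE//.
by rewrite !real_normK ?num_real// cabs_sqr lerDr sqr_ge0.
Qed.

Lemma mulr_conjc z : z * conjc z = (cabs z ^+ 2)%:C.
Proof.
rewrite cabs_sqr; case: z => x y.
by apply/eqP; rewrite eq_complex /=; apply/andP; split; apply/eqP; ring.
Qed.

Lemma ReM z w : complex.Re (z * w) =
  complex.Re z * complex.Re w - complex.Im z * complex.Im w.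
Proof. by case: z => ? ?; case: w. Qed.

Lemma ImM z w : complex.Im (z * w) =
  complex.Re z * complex.Im w + complex.Im z * complex.Re w.
Proof. by case: z => ? ?; case: w. Qed.

Lemma ReD z w : complex.Re (z + w) = complex.Re z + complex.Re w.
Proof. by case: z => ? ?; case: w. Qed.

Lemma ImD z w : complex.Im (z + w) = complex.Im z + complex.Im w.
Proof. by case: z => ? ?; case: w. Qed.

Lemma Re_sum (I : Type) (r : seq I) (P : pred I) (F : I -> R[i]) :
  complex.Re (\sum_(i <- r | P i) F i) = \sum_(i <- r | P i) complex.Re (F i).
Proof. by apply: (big_morph _ ReD). Qed.

Lemma cexpiD t u : cexpi (t + u) = cexpi t * cexpi u.
Proof.
by apply/eqP; rewrite eq_complex /= cosD sinD eqxx /= addrC.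
Qed.

Lemma cexpi0 : cexpi (0 : R) = 1.
Proof. by rewrite /cexpi cos0 sin0. Qed.

Lemma cexpiN t : cexpi (- t) = conjc (cexpi t).
Proof. by rewrite /cexpi cosN sinN. Qed.

Lemma cabs_cexpi t : cabs (cexpi t) = 1.
Proof. by rewrite /cabs /= cos2Dsin2 sqrtr1. Qed.

Lemma cexpi_sum (I : Type) (r : seq I) (P : pred I) (F : I -> R) :
  cexpi (\sum_(i <- r | P i) F i) = \prod_(i <- r | P i) cexpi (F i).
Proof. exact: (big_morph _ cexpiD cexpi0). Qed.

Lemma cexpi_nat n : cexpi (2 * pi * n%:R : R) = 1.
Proof.
elim: n => [|n IH]; first by rewrite mulr0 cexpi0.
rewrite -(natr1 n) mulrDr cexpiD IH mul1r mulr1 /cexpi mulr_natl.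
by rewrite cos2pi sin2pi.
Qed.

Lemma cexpi_int (d : int) : cexpi (2 * pi * d%:~R : R) = 1.
Proof.
case: d => n; first exact: cexpi_nat.
by rewrite NegzE mulrNz mulrN cexpiN -pmulrn cexpi_nat conjc1.
Qed.

(** Reduce [d] modulo [N]. A non-zero remainder r would give cos (2 pi r / N) = 1 - 2 sin^2 (pi r /
    N) < 1, because pi r / N lies strictly between 0 and pi. *)
Lemma cexpi_eq1 (d : int) (N : nat) : (0 < N)%N ->
  cexpi (2 * pi * (d%:~R / N%:R) : R) = 1 -> (N %| d)%Z.
Proof.
move=> N0; have N0' : (N%:R : R) != 0 by rewrite pnatr_eq0 -lt0n.
have r0 : (0 <= (d %% N)%Z)%R by rewrite modz_ge0// -lt0n.
have rN : ((d %% N)%Z < N)%R by rewrite ltz_pmod.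
have -> : (d%:~R / N%:R : R) = (d %/ N)%Z%:~R + (d %% N)%Z%:~R / N%:R.
  by rewrite {1}(divz_eq d N) intrD intrM -[N%:~R]pmulrn [LHS]mulrDl mulfK.
rewrite mulrDr cexpiD cexpi_int mul1r => e1.
apply/dvdz_mod0P; move: r0 rN e1.
case: (d %% N)%Z => [[|n]|n] // _ ltn [] + _.
set u := pi * (n.+1%:R / N%:R) : R.
have -> : 2 * pi * (n.+1%:R / N%:R) = u *+ 2 by rewrite /u -mulrA mulr_natl.
have u0 : 0 < sin u.
  apply: sin_gt0_pi; rewrite /u mulr_gt0 ?pi_gt0 ?divr_gt0 ?ltr0n//=.
  by rewrite gtr_pMr ?pi_gt0// ltr_pdivrMr ?ltr0n// mul1r ltr_nat.
rewrite cos_mulr2n cos2sin2 => e; exfalso.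
by have := exprn_gt0 2 u0; lra.
Qed.

End ComplexModulus.

(** * Orthogonality of characters on the cube *)

Section Characters.
Variable R : realType.

Lemma measurable_cos_comp d (T : measurableType d) (f : T -> R) :
  measurable_fun setT f -> measurable_fun setT (cos \o f).
Proof.
move=> mf; apply: measurableT_comp => //.
by apply: continuous_measurable_fun => x; exact: continuous_cos.
Qed.

Lemma integrable_cos_comp d (T : measurableType d) (P : probability T R)
    (f : T -> R) :
  measurable_fun setT f -> P.-integrable setT (EFin \o (cos \o f)).
Proof.
move=> mf; apply: measurable_bounded_integrable => //.
- by apply: (le_lt_trans (probability_le1 P measurableT)); rewrite ltry.
- exact: measurable_cos_comp.
- exists 1; split; first exact: num_real.
  by move=> M M1 x _ /=; exact: le_trans (cos_max _) (ltW M1).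
Qed.

Lemma integral_uniform_cos (n : int) (c : R) :
  (\int[uniform_prob (@ltr01 R)]_x (cos (2 * pi * (n%:~R * x) + c))%:E =
   ((n == 0)%:R * cos c)%:E)%E.
Proof.
have [->|n0] := eqVneq n 0.
  under eq_integral do rewrite mul0r mulr0 add0r.
  rewrite integral_cst//= probability_setT mule1 mul1r//.
pose w := 2 * pi * n%:~R : R.
have w0 : w != 0.
  by rewrite !mulf_neq0 ?pnatr_eq0 ?intr_eq0// gt_eqF// pi_gt0.
(* [integral_uniform] is applied to a non-negative integrand, hence the shift by 1; it is cancelled
   at the end. *)
pose f x := cos (w * x + c) + 1 : R.
have mlin : measurable_fun setT (fun x : R => w * x + c).
  by apply: measurable_funD => //; exact: measurable_funM.
have dlin (x : R) : is_derive x (1 : R) (fun x : R => w * x + c) w.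
  apply: is_derive_eq.
  by rewrite addr0 /GRing.scale /= mulr1.
have cf : continuous f.
  move=> x; apply: cvgD; last exact: cvg_cst.
  apply: continuous_comp; last exact: continuous_cos.
  by apply: differentiable_continuous; apply/derivable1_diffP.
have f0 x : 0 <= f x by rewrite /f -lerBlDr sub0r cos_geN1.
have mf : measurable_fun setT f by exact: continuous_measurable_fun.
pose F x := w^-1 * sin (w * x + c) + x : R.
have dF (x : R) : is_derive x (1 : R) F (f x).
  apply: is_derive_eq.
  by rewrite /GRing.scale /= mulrCA mulVf ?mulr1.
have Ff : (\int[uniform_prob (@ltr01 R)]_x (f x)%:E = 1)%E.
  rewrite integral_uniform//=; last exact/measurable_EFinP.
  rewrite subr0 invr1 mul1e (@continuous_FTC2 _ _ F)//.
  - rewrite -EFinB /F mulr1 mulr0 add0r addr0.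
    have -> : sin (w + c) = sin c.
      have : cexpi w = 1 by rewrite /w cexpi_int.
      by move=> []; rewrite sinD => -> ->; rewrite mul0r mul1r add0r.
    by congr EFin; ring.
  - exact: continuous_subspaceT.
  - split.
    + by move=> x _; exact: ex_derive.
    + apply: cvg_at_right_filter.
      by apply: differentiable_continuous; apply/derivable1_diffP.
    + apply: cvg_at_left_filter.
      by apply: differentiable_continuous; apply/derivable1_diffP.
  - by move=> x _; rewrite derive1E; exact: derive_val.
have := Ff; rewrite mul0r.
under eq_integral do rewrite EFinD.
rewrite integralD//=; last 2 first.
- exact: integrable_cos_comp.
- exact: finite_measure_integrable_cst.
rewrite integral_cst//= probability_setT mule1.
under eq_integral do rewrite /w -mulrA.
case: (integral _ _ _) => [r|//|//].
by rewrite -EFinD => -[]; rewrite -[RHS]add0r => /addIr ->.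
Qed.

Lemma measurable_dotp s (h : s.-tuple int) :
  measurable_fun setT (fun x : point R s => dotp h x).
Proof.
apply: measurable_sum => j; apply: measurable_funM => //.
exact: measurable_tnth.
Qed.

Lemma dotp_cons s (h : s.+1.-tuple int) (p : measurableTypeR R * point R s) :
  dotp h (point_cons p) = (thead h)%:~R * p.1 + dotp [tuple of behead h] p.2.
Proof.
rewrite /dotp big_ord_recl; congr (_ + _).
apply: eq_bigr => j _; congr (_%:~R * _).
  by rewrite !(tnth_nth 0) /= nth_behead.
by rewrite !(tnth_nth (0 : R)).
Qed.

Definition zero_freq s : s.-tuple int := [tuple of nseq s 0].

(** The free phase [c] makes the induction work: after Fubini, the contribution of the first
    coordinate becomes part of the phase of the inner integral. The phase -pi/2 covers the sine,
    that is, the imaginary part of a character. *)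
Lemma integral_cube_cos s (h : s.-tuple int) (c : R) :
  (\int[cube_prob R s]_x (cos (2 * pi * dotp h x + c))%:E =
   ((h == zero_freq s)%:R * cos c)%:E)%E.
Proof.
elim: s h c => [|s IH] h c.
  rewrite /= integral_dirac//; last first.
    apply/measurable_EFinP; apply: measurable_cos_comp.
    apply: measurable_funD => //; apply: measurable_funM => //.
    exact: measurable_dotp.
  rewrite diracT mul1e /dotp big_ord0 mulr0 add0r.
  by rewrite [h]tuple0 [zero_freq 0]tuple0 eqxx mul1r.
pose g (p : measurableTypeR R * point R s) : R :=
  2 * pi * ((thead h)%:~R * p.1 + dotp [tuple of behead h] p.2) + c.
have intg : (uniform_prob (@ltr01 R) \x cube_prob R s)%E.-integrable setT
    (EFin \o (cos \o g)).
  apply: integrable_cos_comp.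
  apply: measurable_funD => //; apply: measurable_funM => //.
  apply: measurable_funD; first exact: measurable_funM.
  exact: measurableT_comp (measurable_dotp _) measurable_snd.
have gE : (fun x : point R s.+1 => (cos (2 * pi * dotp h x + c))%:E) \o
    @point_cons R s = EFin \o (cos \o g).
  by apply/funext => p /=; rewrite dotp_cons.
rewrite /= (@integral_distribution _ _ _ _ _ _ (@point_cons R s)
  (fun x => (cos (2 * pi * dotp h x + c))%:E)); last 2 first.
- apply/measurable_EFinP; apply: measurable_cos_comp.
  apply: measurable_funD => //; apply: measurable_funM => //.
  exact: measurable_dotp.
- by rewrite gE.
rewrite gE -integral12_prod_meas1// /fubini_F.
transitivity (\int[uniform_prob (@ltr01 R)]_x
  (([tuple of behead h] == zero_freq s)%:R%:E *
   (cos (2 * pi * ((thead h)%:~R * x) + c))%:E))%E.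
  apply: eq_integral => x _; rewrite -EFinM -IH.
  by apply: eq_integral => y _; rewrite /= /g /= mulrDr addrAC addrC.
rewrite integralZl//; last first.
  apply: integrable_cos_comp.
  by apply: measurable_funD => //; do 2 apply: measurable_funM => //.
rewrite integral_uniform_cos -EFinM mulrA -natrM mulnb; congr (_%:R * _)%:E.
congr (nat_of_bool _); rewrite andbC.
by case: h {g intg gE} => -[|h1 h2] // hs; rewrite -!val_eqE.
Qed.

End Characters.

(** * Fourier coefficients and Parseval's identity for trigonometric polynomials *)

Section Fourier.
Variables (R : realType) (s : nat).
Implicit Types (f g : point R s -> R[i]) (h k : s.-tuple int) (x : point R s).

Let P := cube_prob R s.

Definition chi h x : R[i] := cexpi (2 * pi * dotp h x).

Definition sub_freq h k : s.-tuple int := [tuple tnth h j - tnth k j | j < s].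

Lemma dotp_sub h k x : dotp (sub_freq h k) x = dotp h x - dotp k x.
Proof.
rewrite /dotp -sumrB; apply: eq_bigr => j _.
by rewrite tnth_mktuple intrB mulrBl.
Qed.

Lemma tnth_zero_freq j : tnth (zero_freq s) j = 0.
Proof. by rewrite (tnth_nth 0) nth_nseq ltn_ord. Qed.

Lemma sub_freq_eq0 h k : (sub_freq h k == zero_freq s) = (h == k).
Proof.
apply/eqP/eqP => [e|->]; apply: eq_from_tnth => j.
  have := congr1 (fun t => tnth t j) e; rewrite tnth_mktuple tnth_zero_freq.
  by move/eqP; rewrite subr_eq0 => /eqP.
by rewrite tnth_mktuple subrr tnth_zero_freq.
Qed.

Lemma chi_sub h k x : chi (sub_freq h k) x = chi h x * conjc (chi k x).
Proof. by rewrite /chi dotp_sub mulrBr cexpiD cexpiN. Qed.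

Lemma cabs_chi h x : cabs (chi h x) = 1.
Proof. exact: cabs_cexpi. Qed.

Lemma chi_conj h x : chi h x * conjc (chi h x) = 1.
Proof. by rewrite mulr_conjc cabs_chi expr1n. Qed.

Lemma measurable_Re_chi h : measurable_fun setT (fun x => complex.Re (chi h x)).
Proof.
by apply: measurable_cos_comp; apply: measurable_funM => //; exact: measurable_dotp.
Qed.

Lemma Im_chi h x : complex.Im (chi h x) = cos (2 * pi * dotp h x - pi / 2).
Proof. by rewrite cosBpihalf. Qed.

Lemma measurable_Im_chi h : measurable_fun setT (fun x => complex.Im (chi h x)).
Proof.
under eq_fun do rewrite Im_chi.
apply: measurable_cos_comp; apply: measurable_funB => //.
by apply: measurable_funM => //; exact: measurable_dotp.
Qed.

Definition cintegrable f : Prop :=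
  P.-integrable setT (fun x => (complex.Re (f x))%:E) /\
  P.-integrable setT (fun x => (complex.Im (f x))%:E).

Lemma cintegrableD f g : cintegrable f -> cintegrable g ->
  cintegrable (fun x => f x + g x).
Proof.
move=> [f1 f2] [g1 g2]; split.
  by under eq_fun do rewrite ReD EFinD; exact: integrableD.
by under eq_fun do rewrite ImD EFinD; exact: integrableD.
Qed.

Lemma cintegrableM f g :
  measurable_fun setT (fun x => complex.Re (g x)) ->
  measurable_fun setT (fun x => complex.Im (g x)) ->
  (exists M, forall x, cabs (g x) <= M) ->
  cintegrable f -> cintegrable (fun x => f x * g x).
Proof.
move=> mR mI [M gM] [f1 f2].
have bR : [bounded complex.Re (g x) | x in setT].
  exists M; split; first exact: num_real.
  move=> N MN x _; apply: le_trans (cabs_Re _) _.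
  exact: le_trans (gM x) (ltW MN).
have bI : [bounded complex.Im (g x) | x in setT].
  exists M; split; first exact: num_real.
  move=> N MN x _; apply: le_trans (cabs_Im _) _.
  exact: le_trans (gM x) (ltW MN).
split.
  under eq_fun do rewrite ReM EFinB !EFinM.
  by apply: integrableB => //; exact: integrableMl.
under eq_fun do rewrite ImM EFinD !EFinM.
by apply: integrableD => //; exact: integrableMl.
Qed.

Lemma cintegrableZ (c : R[i]) f : cintegrable f -> cintegrable (fun x => c * f x).
Proof.
move=> fi; under eq_fun do rewrite mulrC.
by apply: cintegrableM fi => //; exists (cabs c).
Qed.

Lemma cintegrable_cst (c : R[i]) : cintegrable (fun=> c).
Proof. by split; exact: finite_measure_integrable_cst. Qed.

Lemma cintegrable_chi h : cintegrable (chi h).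
Proof.
rewrite (_ : chi h = fun x => 1 * chi h x); last first.
  by apply/funext => x; rewrite mul1r.
apply: cintegrableM (cintegrable_cst 1).
- exact: measurable_Re_chi.
- exact: measurable_Im_chi.
- by exists 1 => x; rewrite cabs_chi.
Qed.

Lemma cintegrable_sum (I : eqType) (r : seq I) (F : I -> point R s -> R[i]) :
  (forall i, i \in r -> cintegrable (F i)) ->
  cintegrable (fun x => \sum_(i <- r) F i x).
Proof.
elim: r => [|i r IH] Fi.
  by under eq_fun do rewrite big_nil; exact: cintegrable_cst.
under eq_fun do rewrite big_cons.
apply: cintegrableD; first by apply: Fi; rewrite mem_head.
by apply: IH => j jr; apply: Fi; rewrite in_cons jr orbT.
Qed.

Lemma cintegralD f g : cintegrable f -> cintegrable g ->
  cintegral (fun x => f x + g x) = cintegral f + cintegral g.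
Proof.
move=> [f1 f2] [g1 g2]; apply/eqP; rewrite eq_complex /=.
under eq_Rintegral do rewrite ReD.
under [X in _ && (X == _)]eq_Rintegral do rewrite ImD.
by rewrite !RintegralD// !eqxx.
Qed.

Lemma cintegralZ (c : R[i]) f : cintegrable f ->
  cintegral (fun x => c * f x) = c * cintegral f.
Proof.
case: c => u v [f1 f2]; apply/eqP; rewrite eq_complex /=.
have iZ (w : R) (g : point R s -> R) : P.-integrable setT (EFin \o g) ->
    P.-integrable setT (EFin \o (fun x => w * g x)).
  by move=> gi; apply: (integrableZl measurableT w gi).
under eq_Rintegral do rewrite ReM.
under [X in _ && (X == _)]eq_Rintegral do rewrite ImM.
rewrite RintegralB ?RintegralD ?RintegralZl//=; try exact: iZ.
by rewrite !eqxx.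
Qed.

Lemma cintegral_sum (I : eqType) (r : seq I) (F : I -> point R s -> R[i]) :
  (forall i, i \in r -> cintegrable (F i)) ->
  cintegral (fun x => \sum_(i <- r) F i x) = \sum_(i <- r) cintegral (F i).
Proof.
elim: r => [|i r IH] Fi.
  under eq_fun do rewrite big_nil.
  by rewrite big_nil /cintegral /= !Rintegral_cst// !mul0r.
under eq_fun do rewrite big_cons.
rewrite cintegralD ?big_cons ?IH//.
- by move=> j jr; apply: Fi; rewrite in_cons jr orbT.
- by apply: Fi; rewrite mem_head.
- by apply: cintegrable_sum => j jr; apply: Fi; rewrite in_cons jr orbT.
Qed.

Lemma cintegral_chi h : cintegral (chi h) = (h == zero_freq s)%:R.
Proof.
apply/eqP; rewrite eq_complex /= /Rintegral; apply/andP; split; apply/eqP.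
  under eq_integral do rewrite -[2 * pi * _]addr0.
  by rewrite integral_cube_cos /= cos0 mulr1; case: eqP.
under eq_integral do rewrite -cosBpihalf.
rewrite integral_cube_cos /= cosN cos_pihalf mulr0; by case: eqP.
Qed.

Lemma fourierE f h : fourier f h = cintegral (fun x => f x * conjc (chi h x)).
Proof. by rewrite /fourier; under eq_fun do rewrite cexpiN. Qed.

Lemma cintegrableM_conj_chi f h :
  cintegrable f -> cintegrable (fun x => f x * conjc (chi h x)).
Proof.
have chiN (x : point R s) : conjc (chi h x) = chi (sub_freq (zero_freq s) h) x.
  rewrite chi_sub [chi (zero_freq s) x](_ : _ = 1) ?mul1r//.
  rewrite /chi /dotp big1 ?mulr0 ?cexpi0// => j _.
  by rewrite tnth_zero_freq mul0r.
move=> fi; rewrite (_ : (fun _ => _) =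
    fun x => f x * chi (sub_freq (zero_freq s) h) x); last first.
  by apply/funext => x; rewrite chiN.
apply: cintegrableM fi.
- exact: measurable_Re_chi.
- exact: measurable_Im_chi.
- by exists 1 => x; rewrite cabs_chi.
Qed.

Lemma fourier_lin (c : R[i]) f g h : cintegrable f -> cintegrable g ->
  fourier (fun x => c * f x + g x) h = c * fourier f h + fourier g h.
Proof.
move=> fi gi; rewrite !fourierE -cintegralZ; last exact: cintegrableM_conj_chi.
rewrite -cintegralD; last exact: cintegrableM_conj_chi.
  by under eq_fun do rewrite mulrDl -mulrA.
by apply: cintegrableZ; exact: cintegrableM_conj_chi.
Qed.

Definition trig (r : seq (s.-tuple int)) (c : s.-tuple int -> R[i]) x : R[i] :=
  \sum_(h <- r) c h * chi h x.

Lemma cintegrable_trig r c : cintegrable (trig r c).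
Proof.
by apply: cintegrable_sum => h _; apply: cintegrableZ; exact: cintegrable_chi.
Qed.

Lemma fourier_trig r c h : uniq r ->
  fourier (trig r c) h = if h \in r then c h else 0.
Proof.
move=> ur; rewrite fourierE /trig.
under eq_fun => x.
  rewrite mulr_suml; under eq_bigr do rewrite -mulrA -chi_sub; over.
rewrite cintegral_sum; last first.
  by move=> k _; apply: cintegrableZ; exact: cintegrable_chi.
under eq_bigr => k _.
  rewrite cintegralZ ?cintegral_chi ?sub_freq_eq0; last exact: cintegrable_chi.
  over.
case: ifPn => hr.
  rewrite (bigD1_seq h)//= eqxx mulr1 big1 ?addr0// => k /negbTE ->.
  by rewrite mulr0.
rewrite big_seq big1// => k kr; case: eqP => [kh|]; last by rewrite mulr0.
by move: hr; rewrite -kh kr.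
Qed.

(** Parseval's identity: expanding only the conjugate factor of |f|^2 turns every term into a
    Fourier coefficient of f, which [fourier_trig] evaluates. *)
Lemma integral_sqr_trig r c : uniq r ->
  (\int[P]_x ((cabs (trig r c x)) ^+ 2)%:E = (\sum_(h <- r) cabs (c h) ^+ 2)%:E)%E.
Proof.
move=> ur.
have fi : cintegrable (fun x => trig r c x * conjc (trig r c x)).
  under eq_fun => x.
    rewrite {2}/trig rmorph_sum mulr_sumr.
    under eq_bigr do rewrite rmorphM /= mulrCA.
    over.
  apply: cintegrable_sum => h _; apply: cintegrableZ.
  by apply: cintegrableM_conj_chi; exact: cintegrable_trig.
have := fi.1; under eq_fun do rewrite mulr_conjc /=.
move=> ii; rewrite -[LHS]fineK; last exact: integrable_fin_num.
congr EFin.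
have -> : fine (\int[P]_x ((cabs (trig r c x)) ^+ 2)%:E) =
   complex.Re (cintegral (fun x => trig r c x * conjc (trig r c x))).
  by rewrite /= /Rintegral; under [in RHS]eq_integral do rewrite mulr_conjc.
have -> : (fun x => trig r c x * conjc (trig r c x)) =
    (fun x => \sum_(h <- r) conjc (c h) * (trig r c x * conjc (chi h x))).
  apply/funext => x; rewrite {2}/trig rmorph_sum mulr_sumr.
  by apply: eq_bigr => h _; rewrite rmorphM /= mulrCA.
rewrite cintegral_sum; last first.
  move=> h _; apply: cintegrableZ.
  by apply: cintegrableM_conj_chi; exact: cintegrable_trig.
rewrite Re_sum big_seq [RHS]big_seq; apply: eq_bigr => h hr.
rewrite cintegralZ; last by apply: cintegrableM_conj_chi; exact: cintegrable_trig.
by rewrite -fourierE fourier_trig// hr mulrC mulr_conjc.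
Qed.

End Fourier.

(** * Lower bound for the minimal error *)

Section LowerBound.
Variables (R : realType) (omega : R) (a b : nat -> R) (s : nat).
Hypothesis homega : 0 < omega < 1.
Implicit Types (h : s.-tuple int) (r : seq (s.-tuple int)).
Implicit Types (c : s.-tuple int -> R[i]).

Local Notation om := (omega_h omega a b).

Lemma omega_h_gt0 h : 0 < om h.
Proof. by apply: powR_gt0; case/andP: homega. Qed.

Lemma L2norm_trig r c : uniq r ->
  L2norm (trig r c : point R s -> _) =
    (Num.sqrt (\sum_(h <- r) cabs (c h) ^+ 2))%:E.
Proof.
move=> ur; rewrite /L2norm unlock.
rewrite (eq_integral (fun x => (cabs (trig r c x) ^+ 2)%:E)); last first.
  by move=> x _; rewrite abse_EFin poweR_EFin ger0_norm ?powR_mulrn ?cabs_ge0.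
rewrite integral_sqr_trig// poweR_EFin powR12_sqrt//.
by apply: sumr_ge0 => h _; rewrite sqr_ge0.
Qed.

Lemma Hnorm_trig r c : uniq r ->
  Hnorm omega a b (trig r c : point R s -> _) =
    (Num.sqrt (\sum_(h <- r) cabs (c h) ^+ 2 / om h))%:E.
Proof.
move=> ur; rewrite /Hnorm (_ : \esum_(_ in _) _ =
    (\sum_(h <- r) cabs (c h) ^+ 2 / om h)%:E)//.
transitivity (\esum_(h in [set` r]) (cabs (c h) ^+ 2 / om h)%:E)%E.
  rewrite [RHS]esum_mkcond; apply: eq_esum => h _.
  rewrite fourier_trig// mem_setE.
  by case: ifP => // _; rewrite cabs0 expr0n mul0r.
rewrite esum_fset; last first.
- by move=> h _; rewrite lee_fin divr_ge0 ?sqr_ge0// ltW// omega_h_gt0.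
- exact: finite_seq.
by rewrite -fsbig_seq// sumEFin.
Qed.

Lemma has_sum_trig r c (x : point R s) : uniq r ->
  has_sum (fun h => fourier (trig r c) h * cexpi (2 * pi * dotp h x))
    (trig r c x).
Proof.
move=> ur e e0; exists [fset h in r]%fset => B rB.
rewrite (_ : \sum_(_ <- _) _ = trig r c x) ?subrr ?cabs0//.
under eq_bigr => h _ do rewrite fourier_trig//.
transitivity (\sum_(h <- [fset h in r]%fset)
    (if h \in r then c h else 0) * chi h x); last first.
  have pr : perm_eq [fset h in r]%fset r.
    by apply: uniq_perm => // h; rewrite inE.
  rewrite (perm_big _ pr) /trig [RHS]big_seq [LHS]big_seq /=.
  by apply: eq_bigr => h ->.
rewrite [RHS](big_fset_incl _ rB)// => h _; rewrite inE /= => /negbTE ->.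
by rewrite mul0r.
Qed.

Lemma in_H_trig r c : uniq r -> in_H omega a b (trig r c : point R s -> _).
Proof.
move=> ur; have [? ?] := cintegrable_trig (R := R) r c.
split=> //; first by move=> x; exact: has_sum_trig.
by rewrite Hnorm_trig// ltry.
Qed.

Lemma linear_trig (L : functional R s) r c : uniq r ->
  linear_on_H omega a b L -> L (trig r c) = \sum_(h <- r) c h * L (chi h).
Proof.
move=> + linL; elim: r => [_|h r IH /= /andP[hr ur]].
  have H0 : in_H omega a b (trig [::] c : point R s -> _) by exact: in_H_trig.
  rewrite big_nil; have := linL 1 _ _ H0 H0.
  rewrite (_ : (fun _ => _) = trig [::] c); last first.
    by apply/funext => x; rewrite /trig big_nil mulr0 addr0.
  by rewrite mul1r => /eqP; rewrite -subr_eq0 opprD addNKr oppr_eq0 => /eqP.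
have chiE : chi h = trig [:: h] (fun=> 1) :> (point R s -> _).
  by apply/funext => x; rewrite /trig big_seq1 mul1r.
rewrite big_cons -IH// -linL; last 2 first.
- by rewrite chiE; exact: in_H_trig.
- exact: in_H_trig.
by congr L; apply/funext => x; rewrite /trig big_cons.
Qed.

(** All that the lower bound uses about the information; from here on it does not distinguish the
    two classes. *)
Lemma admissible_trig Lam (L : functional R s) r c : uniq r ->
  admissible omega a b Lam L -> L (trig r c) = \sum_(h <- r) c h * L (chi h).
Proof.
case: Lam => ur; first by move=> [linL _]; exact: linear_trig.
move=> [x _ Lx]; rewrite Lx; last exact: in_H_trig.
rewrite /trig; apply: eq_bigr => h _.
have chiE : chi h = trig [:: h] (fun=> 1) :> (point R s -> _).
  by apply/funext => y; rewrite /trig big_seq1 mul1r.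
by rewrite Lx// chiE; exact: in_H_trig.
Qed.

(** The matrix of the values [L k h] has more rows than columns, hence a non-zero vector in its left
    kernel; read by position in [r], this vector is [c]. *)
Lemma common_kernel n r (L : 'I_n -> s.-tuple int -> R[i]) : (n < size r)%N ->
  uniq r ->
  exists c, (exists2 h, h \in r & c h != 0) /\
    forall k, \sum_(h <- r) c h * L k h = 0.
Proof.
move=> nr ur; pose h0 := zero_freq s.
pose M := \matrix_(i < size r, k < n) L k (nth h0 r i).
have : kermx M != 0.
  rewrite kermx_eq0 /row_free; apply/negP => /eqP rM.
  by have := rank_leq_col M; rewrite rM leqNgt nr.
move=> /rowV0Pn[v /sub_kermxP vM v0].
pose c h := if insub (index h r) is Some i then v 0 i else 0.
have cE (i : 'I_(size r)) : c (nth h0 r i) = v 0 i.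
  by rewrite /c index_uniq// valK.
exists c; split.
  move/rV0Pn : v0 => [i vi]; exists (nth h0 r i); first exact: mem_nth.
  by rewrite cE.
move=> k; rewrite (big_nth h0) big_mkord.
have := congr1 (fun A : 'rV_n => A 0 k) vM; rewrite !mxE => {2}<-.
by apply: eq_bigr => i _; rewrite cE mxE.
Qed.

Lemma min_error_ge Lam n r (d : R) : uniq r -> (n < size r)%N -> 0 <= d ->
  (forall h, h \in r -> d ^+ 2 <= om h) ->
  (d%:E <= min_error omega a b Lam n s)%E.
Proof.
move=> ur nr d0 dr; apply: le_ereal_inf_tmp => _ [[al L] [/= _ admL] <-].
have [c [[h1 h1r c1] Lc]] := @common_kernel n r (fun k h => L k (chi h)) nr ur.
pose N := \sum_(h <- r) cabs (c h) ^+ 2 / om h.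
have t0 h : 0 <= cabs (c h) ^+ 2 / om h.
  by rewrite divr_ge0 ?sqr_ge0// ltW// omega_h_gt0.
have N0 : 0 < N.
  rewrite /N (bigD1_seq h1)//= ltr_pwDl ?sumr_ge0//.
  by rewrite divr_gt0 ?omega_h_gt0// exprn_gt0// lt_def cabs_eq0 c1 cabs_ge0.
pose c' h := ((Num.sqrt N)^-1)%:C * c h.
have cabs_c' h : cabs (c' h) ^+ 2 = N^-1 * cabs (c h) ^+ 2.
  rewrite /c' cabsM cabs_real ger0_norm ?invr_ge0// exprMn exprVn.
  by rewrite sqr_sqrtr// ltW.
have fH : in_H omega a b (trig r c' : point R s -> _) by exact: in_H_trig.
apply: le_ereal_sup_tmp; exists (L2norm (trig r c' : point R s -> _)).
  exists (trig r c').
    split=> //; rewrite Hnorm_trig// lee_fin.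
    under eq_bigr do rewrite cabs_c' -mulrA.
    by rewrite -mulr_sumr mulVf ?sqrtr1// gt_eqF.
  congr L2norm; apply/funext => x; rewrite /algorithm big1 ?subr0// => k _.
  rewrite (admissible_trig _ ur (admL k)).
  under eq_bigr do rewrite /c' -mulrA.
  by rewrite -mulr_sumr Lc !mulr0.
rewrite L2norm_trig// lee_fin -(ger0_norm d0) -sqrtr_sqr ler_wsqrtr//.
under eq_bigr do rewrite cabs_c'.
rewrite -mulr_sumr mulrC ler_pdivlMr// mulr_sumr big_seq [leRHS]big_seq.
apply: ler_sum => h hr; rewrite mulrCA ler_piMr ?sqr_ge0//.
by rewrite ler_pdivrMr ?mul1r ?dr// omega_h_gt0.
Qed.

End LowerBound.

(** * Weighted sums over frequencies *)

Lemma ler_sum_subset (R : numDomainType) (I : eqType) (r1 r2 : seq I)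
    (F : I -> R) : uniq r1 -> uniq r2 -> {subset r1 <= r2} ->
  (forall i, 0 <= F i) -> \sum_(i <- r1) F i <= \sum_(i <- r2) F i.
Proof.
move=> u1 u2 s12 F0.
have p12 : perm_eq r1 [seq i <- r2 | i \in r1].
  apply: uniq_perm => //; first exact: filter_uniq.
  by move=> i; rewrite mem_filter andb_idr// => /s12.
rewrite (perm_big _ p12) /= big_filter big_mkcond /=.
by apply: ler_sum => i _; case: ifP.
Qed.

(** The list [r] is enlarged to the product of its set of heads and its set of tails, over which the
    sum factors; since all terms are non-negative, the sum can only grow. *)
Lemma ler_sum_tuple_prod (R : numDomainType) (T : eqType) s
    (g : nat -> T -> R) (S : nat -> R) (r : seq (s.-tuple T)) :
  (forall j i, 0 <= g j i) ->
  (forall j (t : seq T), (j < s)%N -> uniq t -> \sum_(i <- t) g j i <= S j) ->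
  uniq r ->
  \sum_(h <- r) \prod_(j < s) g j (tnth h j) <= \prod_(j < s) S j.
Proof.
elim: s g S r => [|s IH] g S r g0 gS ur.
  under eq_bigr do rewrite big_ord0; rewrite big_ord0.
  apply: (@le_trans _ _ (\sum_(h <- [:: [tuple] : 0.-tuple T]) 1)).
    by apply: ler_sum_subset => // h _; rewrite [h]tuple0 mem_head.
  by rewrite big_seq1.
pose hd := undup [seq thead h | h <- r].
pose bh (h : s.+1.-tuple T) : s.-tuple T := [tuple of behead h].
pose tl := undup [seq bh h | h <- r].
pose F (h : s.+1.-tuple T) := \prod_(j < s.+1) g j (tnth h j).
have F0 h : 0 <= F h by apply: prodr_ge0.
apply: (@le_trans _ _ (\sum_(h <- [seq [tuple of i :: t] | i <- hd, t : s.-tuple T <- tl]) F h)).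
  apply: ler_sum_subset => //.
    apply: allpairs_uniq; rewrite ?undup_uniq// => -[i t] [i' t'] _ _ /= /(congr1 val)/= [-> ett].
    by congr pair; exact: val_inj.
  move=> h hr; apply/allpairsP; exists (thead h, bh h).
  rewrite !mem_undup; split; try by apply/mapP; exists h.
  exact: tuple_eta.
rewrite big_allpairs_dep /=.
have -> : \sum_(i <- hd) \sum_(t <- tl) F [tuple of i :: t] =
    (\sum_(i <- hd) g 0%N i) *
      \sum_(t <- tl) \prod_(j < s) g j.+1 (tnth t j).
  rewrite mulr_suml; apply: eq_bigr => i _.
  rewrite mulr_sumr; apply: eq_bigr => t _.
  rewrite /F big_ord_recl tnth0; congr (_ * _).
  by apply: eq_bigr => j _; rewrite tnthS.
rewrite big_ord_recl ler_pM//.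
- by apply: sumr_ge0.
- by apply: sumr_ge0 => t _; apply: prodr_ge0.
- by apply: gS; rewrite ?undup_uniq.
- apply: (IH (fun j => g j.+1) (fun j => S j.+1)) => //; last exact: undup_uniq.
  by move=> j t js; exact: gS.
Qed.

Section WeightSums.
Variables (R : realType) (omega : R) (a b : nat -> R).
Hypothesis homega : 0 < omega < 1.
Hypothesis a_ge1 : forall j, (1 <= j)%N -> 1 <= a j.
Hypothesis b_ge1 : forall j, (1 <= j)%N -> 1 <= b j.

(* [omega_h omega a b h] is convertible to [omega `^ weight_exponent a b h]. *)
Definition weight_exponent s (h : s.-tuple int) : R :=
  \sum_(j < s) a j.+1 * ((`|tnth h j|%N)%:R `^ b j.+1).

Lemma sum_geometric_le (u : R) n : 0 <= u < 1 ->
  \sum_(i < n) u ^+ i <= (1 - u)^-1.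
Proof.
move=> /andP[u0 u1]; have u1' : 0 < 1 - u by rewrite subr_gt0.
rewrite -[leRHS]mul1r ler_pdivlMr// -[_ * _]opprK -mulrN opprB.
rewrite mulrC -subrX1 opprB lerBlDr lerDl exprn_ge0//.
Qed.

Lemma sum_int_powers_le (u : R) (r : seq int) : 0 <= u < 1 -> uniq r ->
  \sum_(i <- r) u ^+ `|i|%N <= 1 + 2 * (u / (1 - u)).
Proof.
move=> u01 ur; have /andP[u0 u1] := u01.
have [K Kr] : exists K, forall i, i \in r -> (`|i| < K)%N.
  exists (\max_(i <- r) `|i|%N).+1 => i ir.
  by rewrite ltnS; exact: (@leq_bigmax_seq _ _ xpredT (fun i : int => `|i|%N)).
pose r2 := [seq Posz n | n <- iota 0 K] ++ [seq Negz n | n <- iota 0 K].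
apply: (@le_trans _ _ (\sum_(i <- r2) u ^+ `|i|%N)).
  apply: ler_sum_subset => //; last by move=> i; exact: exprn_ge0.
    rewrite cat_uniq !map_inj_uniq ?iota_uniq//=; try by move=> ? ? [].
    by rewrite andbT; apply/hasPn => _ /mapP[n _ ->]; apply/negP => /mapP[].
  move=> i /Kr; rewrite mem_cat.
  case: i => n /= ni; apply/orP; [left|right]; apply: map_f.
    by rewrite mem_iota add0n.
  by rewrite mem_iota add0n; exact: ltnW.
rewrite big_cat /= !big_map.
have -> : iota 0 K = index_iota 0 K by rewrite /index_iota subn0.
rewrite !big_mkord /=.
have g1 := sum_geometric_le K u01.
have -> : \sum_(i < K) u ^+ i.+1 = u * \sum_(i < K) u ^+ i.
  by rewrite mulr_sumr; apply: eq_bigr => i _; rewrite exprS.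
have e1 : (1 - u)^-1 = 1 + u / (1 - u) by field; rewrite gt_eqF// subr_gt0.
have : u * \sum_(i < K) u ^+ i <= u / (1 - u) by rewrite ler_wpM2l.
move: g1; rewrite {1}e1; lra.
Qed.

Lemma powR_ge_id (n : nat) (p : R) : 1 <= p -> (n%:R : R) <= n%:R `^ p.
Proof.
move=> p1; case: n => [|n]; first exact: powR_ge0.
by rewrite -[leLHS]powRr1// ler_powR// ler1n.
Qed.

Lemma powR_sum (I : Type) (r : seq I) (F : I -> R) (x : R) : 0 < x ->
  x `^ (\sum_(i <- r) F i) = \prod_(i <- r) x `^ F i.
Proof.
move=> x0; elim/big_rec2 : _ => [|i y z _ <-]; first by rewrite powRr0.
by apply: powRD; rewrite (gt_eqF x0) implybT.
Qed.

(** Since |h_j|^(b_j) >= |h_j|, coordinate j is dominated by a two-sided geometric series of ratio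
    omega^(t a_j) <= omega^t. This removes b from the bound and makes the denominator independent of
    j. The values of [t] used are 1 for the continuity of evaluations, 1/2 for tails, and
    arbitrarily small ones for counting frequencies. *)
Lemma sum_weights_le s (r : seq (s.-tuple int)) (t : R) : 0 < t -> uniq r ->
  \sum_(h <- r) omega `^ (t * weight_exponent h) <=
  \prod_(j < s) (1 + 2 / (1 - omega `^ t) * omega `^ (t * a j.+1)).
Proof.
move=> t0 ur; have /andP[w0 w1] := homega.
pose g j (i : int) := omega `^ (t * (a j.+1 * ((`|i|%N)%:R `^ b j.+1))).
pose S j := 1 + 2 / (1 - omega `^ t) * omega `^ (t * a j.+1).
rewrite (eq_bigr (fun h : s.-tuple int => \prod_(j < s) g j (tnth h j))); last first.
  by move=> h _; rewrite /weight_exponent mulr_sumr powR_sum.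
apply: (@ler_sum_tuple_prod _ _ s g S r _ _ ur).
  by move=> j i; exact: powR_ge0.
move=> j q js uq; pose u := omega `^ (t * a j.+1).
have aj : 1 <= a j.+1 by exact: a_ge1.
have ut : u <= omega `^ t.
  apply: ger_powR; first by rewrite w0 ltW.
  by rewrite ler_peMr// ltW.
have t1 : omega `^ t < 1.
  by rewrite /powR gt_eqF// expR_lt1 pmulr_rlt0// ln_lt0 ?w0.
have u01 : 0 <= u < 1 by rewrite powR_ge0/= (le_lt_trans ut).
apply: (@le_trans _ _ (\sum_(i <- q) u ^+ `|i|%N)).
  apply: ler_sum => i _; rewrite /g -powR_mulrn ?powR_ge0// /u -powRrM -mulrA.
  apply: ger_powR; first by rewrite w0 ltW.
  by rewrite ler_pM2l// ler_pM2l ?powR_ge_id ?b_ge1// (lt_le_trans ltr01).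
apply: (le_trans (sum_int_powers_le u01 uq)).
rewrite /S -/u lerD2l -mulrA ler_pM2l// mulrC ler_wpM2r ?powR_ge0//.
by rewrite lef_pV2 ?posrE ?subr_gt0// ?(le_lt_trans ut)// lerB.
Qed.

End WeightSums.

(** * Sampling on a finite subgroup of the torus *)

Lemma ler_sum_cauchy_schwarz (R : realType) (I : Type) (r : seq I)
    (w c : I -> R) (T N : R) : 0 < T -> 0 < N -> (forall i, 0 < w i) ->
  \sum_(i <- r) w i <= T -> \sum_(i <- r) c i ^+ 2 / w i <= N ^+ 2 ->
  \sum_(i <- r) c i <= N * Num.sqrt T.
Proof.
move=> T0 N0 w0 wT cN; pose q := Num.sqrt T.
have q0 : 0 < q by rewrite sqrtr_gt0.
have qq : q ^+ 2 = T by rewrite sqr_sqrtr// ltW.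
(* AM-GM: [2 c <= (N / q) w + (q / N) c^2 / w] *)
apply: (@le_trans _ _ (\sum_(i <- r) (N / q * w i + q / N * (c i ^+ 2 / w i)) / 2)).
  apply: ler_sum => i _; rewrite ler_pdivlMr// -subr_ge0.
  have wi := w0 i; have -> : N / q * w i + q / N * (c i ^+ 2 / w i) - c i * 2 =
    (N * w i - q * c i) ^+ 2 / (N * q * w i) by field; rewrite !gt_eqF.
  by rewrite divr_ge0 ?sqr_ge0// ltW// !mulr_gt0.
rewrite -mulr_suml big_split /= -!mulr_sumr ler_pdivrMr//.
have : N / q * (\sum_(i <- r) w i) <= N / q * q ^+ 2.
  by rewrite ler_pM2l ?divr_gt0// qq.
have : q / N * (\sum_(i <- r) c i ^+ 2 / w i) <= q / N * N ^+ 2.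
  by rewrite ler_pM2l ?divr_gt0.
have -> : N / q * q ^+ 2 = N * q by field; rewrite gt_eqF.
have -> : q / N * N ^+ 2 = N * q by field; rewrite gt_eqF.
rewrite -/q; lra.
Qed.

Section CharacterSums.
Variables (R : realType) (s : nat) (I : finZmodType) (x : I -> point R s).
(** A homomorphism into the torus, expressed through characters: the [x i] are representatives in
    R^s, so [x (i + j)] agrees with the sum of [x i] and [x j] only modulo integers. *)
Hypothesis chi_morph : forall d i j, chi d (x (i + j)) = chi d (x i) * chi d (x j).
Implicit Types (h k d : s.-tuple int).

(** Translating the index by [i0] multiplies the sum by a factor different from 1 without changing
    it. *)
Lemma sum_chi_points d : (exists i, chi d (x i) != 1) -> \sum_i chi d (x i) = 0.
Proof.
move=> [i0 di0]; apply/eqP.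
have : (1 - chi d (x i0)) * (\sum_i chi d (x i)) == 0.
  rewrite mulrBl mul1r subr_eq0 mulr_sumr; apply/eqP.
  rewrite [LHS](reindex_inj (addrI i0)).
  by apply: eq_bigr => i _; rewrite chi_morph.
by rewrite mulf_eq0 subr_eq0 eq_sym (negbTE di0).
Qed.

(* On the sample points, [k] cannot be distinguished from [h]. *)
Definition aliased h k : bool := [forall i, chi h (x i) == chi k (x i)].

Lemma aliased_sub h k : aliased h k = [forall i, chi (sub_freq k h) (x i) == 1].
Proof.
apply/eq_forallb => i; rewrite chi_sub.
apply/eqP/eqP => [->|e]; first exact: chi_conj.
have := congr1 (fun z => z * chi h (x i)) e.
by rewrite -mulrA [conjc _ * _]mulrC chi_conj mulr1 mul1r => ->.
Qed.

Lemma mean_chi_points h k :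
  (#|I|%:R)^-1 * \sum_i chi k (x i) * conjc (chi h (x i)) = (aliased h k)%:R.
Proof.
under eq_bigr do rewrite -chi_sub; rewrite aliased_sub.
have I0 : (#|I|%:R : R[i]) != 0.
  by rewrite pnatr_eq0 -lt0n; apply/card_gt0P; exists 0.
have [/forallP al|] := boolP [forall i, chi (sub_freq k h) (x i) == 1].
  under eq_bigr do rewrite (eqP (al _)).
  by rewrite sumr_const mulVf.
rewrite negb_forall => /existsP di.
by rewrite sum_chi_points ?mulr0.
Qed.

Variable G : seq (s.-tuple int).
Hypothesis uniq_G : uniq G.
Hypothesis sepG : {in G &, forall h k, aliased h k -> h = k}.

(** The discrete Fourier sum over [G], regrouped by sample point to have the form of an algorithm:
    this is the function multiplying the value at [x i]. *)
Definition sample_coef (i : I) : point R s -> R[i] :=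
  trig G (fun h => (#|I|%:R)^-1 * conjc (chi h (x i))).

Lemma sample_chi k (y : point R s) :
  \sum_i sample_coef i y * chi k (x i) =
  \sum_(h <- G) (aliased h k)%:R * chi h y.
Proof.
under eq_bigr do rewrite /sample_coef /trig mulr_suml.
rewrite exchange_big; apply: eq_bigr => h _.
rewrite -mean_chi_points mulr_sumr mulr_suml; apply: eq_bigr => i _.
by rewrite -!mulrA; congr (_ * _); rewrite [RHS]mulrC -mulrA.
Qed.

Lemma sample_chi_in k y : k \in G ->
  \sum_i sample_coef i y * chi k (x i) = chi k y.
Proof.
move=> kG; rewrite sample_chi (bigD1_seq k)//= [aliased k k](_ : _ = true).
  rewrite mul1r big_seq_cond big1 ?addr0// => h /andP[hG hk].
  case: (boolP (aliased h k)) => [/(sepG hG kG) e|]; last by rewrite mul0r.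
  by rewrite e eqxx in hk.
by apply/forallP => i.
Qed.

(** Two elements of [G] aliased to the same [k] are aliased to each other, hence equal by [sepG]. So
    at most one character remains in the sum. *)
Lemma cabs_sample_chi k y :
  cabs (\sum_i sample_coef i y * chi k (x i)) <= 1.
Proof.
rewrite sample_chi; have [/hasP[h hG hk]|/hasPn nk] := boolP (has (aliased^~ k) G).
  rewrite (bigD1_seq h)//= hk mul1r big_seq_cond big1 ?addr0 ?cabs_chi//.
  move=> h' /andP[h'G h'h].
  case: (boolP (aliased h' k)) => [h'k|]; last by rewrite mul0r.
  have : aliased h' h.
    by apply/forallP => i; rewrite (eqP (forallP h'k i)) (eqP (forallP hk i)).
  by move=> /(sepG h'G hG) e; rewrite e eqxx in h'h.
rewrite big_seq big1 ?cabs0// => h hG.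
by rewrite (negbTE (nk h hG)) mul0r.
Qed.

End CharacterSums.

(** * The error of sampling on a finite subgroup *)

Section Sampling.
Variables (R : realType) (omega : R) (a b : nat -> R).
Hypothesis homega : 0 < omega < 1.
Hypothesis a_ge1 : forall j, (1 <= j)%N -> 1 <= a j.
Hypothesis b_ge1 : forall j, (1 <= j)%N -> 1 <= b j.
Variable s : nat.
Implicit Types (h k : s.-tuple int) (f g : point R s -> R[i]).

Local Notation om := (@omega_h R omega a b s).

Lemma Hnorm_partial f (N : R) (B : seq (s.-tuple int)) : 0 <= N ->
  (Hnorm omega a b f <= N%:E)%E -> uniq B ->
  \sum_(k <- B) cabs (fourier f k) ^+ 2 / om k <= N ^+ 2.
Proof.
move=> N0 fN uB; set S := \sum_(k <- B) _.
have S0 : 0 <= S.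
  by apply: sumr_ge0 => k _; rewrite divr_ge0 ?sqr_ge0// ltW// omega_h_gt0.
have SH : (S%:E <= \esum_(h in [set: s.-tuple int])
    (cabs (fourier f h) ^+ 2 * (om h)^-1)%:E)%E.
  apply: esum_ge; exists [set` B]; first by split => //; exact: finite_seq.
  by rewrite -fsbig_seq// sumEFin.
have : (S%:E <= (N ^+ 2)%:E)%E; last by rewrite lee_fin.
move: fN SH; rewrite /Hnorm; case: (\esum_(_ in _) _) => [r|//|//].
rewrite /= !lee_fin => rN Sr; apply: (le_trans Sr).
have r0 : 0 <= r by exact: le_trans Sr.
by rewrite -[leLHS]sqr_sqrtr// ler_sqr ?nnegrE.
Qed.

Lemma fourier_sum_le f (N T : R) (B : seq (s.-tuple int)) : 0 < N -> 0 < T ->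
  (Hnorm omega a b f <= N%:E)%E -> uniq B -> \sum_(k <- B) om k <= T ->
  \sum_(k <- B) cabs (fourier f k) <= N * Num.sqrt T.
Proof.
move=> N0 T0 fN uB BT;
apply: (@ler_sum_cauchy_schwarz _ _ _ om (fun k => cabs (fourier f k))) => //.
  by move=> k; exact: omega_h_gt0.
by apply: Hnorm_partial => //; exact: ltW.
Qed.

Definition has_fourier_series f : Prop :=
  forall x, has_sum (fun h => fourier f h * cexpi (2 * pi * dotp h x)) (f x).

(** The algorithm compares f at a point with f at all sample points, so one partial sum must be
    close at all of them: take the union of the frequency sets obtained for each point. *)
Lemma fourier_series_approx f (J : finType) (p : J -> point R s) (e : R) :
  has_fourier_series f -> 0 < e ->
  exists A : {fset s.-tuple int}, forall B : {fset s.-tuple int},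
    (A `<=` B)%fset -> forall j,
      cabs (trig (enum_fset B) (fourier f) (p j) - f (p j)) < e.
Proof.
move=> fs e0; have [A Ap] := choice (fun j => fs (p j) e e0).
exists (\bigcup_(j in J) A j)%fset => B AB j.
apply: Ap; apply: fsubset_trans AB.
exact: bigfcup_sup.
Qed.

(** This is the continuity of point evaluation. It asks for a Fourier series and a norm bound
    instead of [in_H] because it is applied to a difference of two functions of the space. *)
Lemma fourier_eval_le f (N T : R) (x : point R s) : 0 < N -> 0 < T ->
  (forall B : seq (s.-tuple int), uniq B -> \sum_(k <- B) om k <= T) ->
  has_fourier_series f -> (Hnorm omega a b f <= N%:E)%E ->
  cabs (f x) <= N * Num.sqrt T.
Proof.
move=> N0 T0 BT fs fN; apply/ler_addgt0Pr => e e0.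
have [A Ap] := @fourier_series_approx f unit (fun=> x) e fs e0.
have {}Ap := Ap A (fsubset_refl _) tt.
rewrite -[f x](subKr (trig (enum_fset A) (fourier f) x)).
apply: (le_trans (cabsD _ _)); rewrite cabsN; apply: lerD; last exact: ltW.
apply: (le_trans (cabs_sum _ _ _)).
under eq_bigr do rewrite cabsM cabs_chi mulr1.
by apply: fourier_sum_le => //; [exact: fset_uniq|apply: BT; exact: fset_uniq].
Qed.

Lemma has_fourier_seriesB f g : in_H omega a b f -> in_H omega a b g ->
  has_fourier_series (fun x => g x - f x).
Proof.
move=> [f1 f2 fs _] [g1 g2 gs _] x e e0.
have fE k : fourier (fun x => g x - f x) k = fourier g k - fourier f k.
  have := @fourier_lin R s (-1) f g k (conj f1 f2) (conj g1 g2).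
  by under eq_fun do rewrite mulN1r addrC; move=> ->; rewrite mulN1r addrC.
have e2 : 0 < e / 2 by rewrite divr_gt0.
have [A Af] := fs x _ e2; have [A' Ag] := gs x _ e2.
exists (A `|` A')%fset => B; rewrite fsubUset => /andP[AB A'B].
under eq_bigr do rewrite fE mulrBl.
rewrite sumrB (_ : _ - _ - _ = (\sum_(k <- enum_fset B) fourier g k *
    cexpi (2 * pi * dotp k x) - g x) - (\sum_(k <- enum_fset B) fourier f k *
    cexpi (2 * pi * dotp k x) - f x)); last by ring.
apply: (le_lt_trans (cabsD _ _)); rewrite cabsN [e]splitr.
by apply: ltrD; [exact: Ag|exact: Af].
Qed.

Lemma omega_h_sum_bounded : exists2 T : R, 0 < T &
  forall B : seq (s.-tuple int), uniq B -> \sum_(k <- B) om k <= T.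
Proof.
pose T := \prod_(j < s) (1 + 2 / (1 - omega `^ 1) * omega `^ (1 * a j.+1)).
have B0 B : uniq B -> \sum_(k <- B) om k <= T.
  move=> uB; have := sum_weights_le homega a_ge1 b_ge1 ltr01 uB.
  by under eq_bigr do rewrite mul1r.
exists T; last by [].
have := B0 [:: zero_freq s] isT; rewrite big_seq1; apply: lt_le_trans.
exact: omega_h_gt0.
Qed.

Lemma eval_admissible Lam (x : point R s) :
  unit_cube x -> admissible omega a b Lam (fun f => f x).
Proof.
case: Lam => xc; last by exists x.
split=> // f fH e e0; have [T T0 BT] := omega_h_sum_bounded.
have q0 : 0 < Num.sqrt T by rewrite sqrtr_gt0.
exists (e / 2 / Num.sqrt T); first by rewrite !divr_gt0.
move=> g gH gf.
have := @fourier_eval_le (fun x => g x - f x) (e / 2 / Num.sqrt T) T x _ T0 BT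
  (has_fourier_seriesB fH gH) (ltW gf).
rewrite !divr_gt0// => /(_ isT) /le_lt_trans; apply.
by rewrite divfK ?gt_eqF// ltr_pdivrMr// ltr_pMr// ltr1n.
Qed.

Lemma in_H_cintegrable f : in_H omega a b f -> cintegrable f.
Proof. by case. Qed.

Lemma L2norm_le f (M : R) : cintegrable f -> 0 <= M ->
  (forall x, cabs (f x) <= M) -> (L2norm f <= M%:E)%E.
Proof.
move=> [/measurable_int mR /measurable_int mI] M0 fM; rewrite /L2norm unlock.
have -> : M%:E = (((M ^+ 2)%:E : \bar R) `^ 2^-1)%E.
  by rewrite poweR_EFin powR12_sqrt ?sqr_ge0// sqrtr_sqr ger0_norm.
have fE x : ((`|(cabs (f x))%:E| `^ 2)%E : \bar R) = (cabs (f x) ^+ 2)%:E.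
  by rewrite abse_EFin poweR_EFin ger0_norm ?powR_mulrn ?cabs_ge0.
apply: gt0_ler_poweR; rewrite ?invr_ge0//.
- rewrite in_itv /= leey andbT; apply: integral_ge0 => x _.
  by rewrite lee_fin powR_ge0.
- by rewrite in_itv /= leey andbT lee_fin sqr_ge0.
apply: (@le_trans _ _ (\int[cube_prob R s]_x (M ^+ 2)%:E)%E).
  apply: ge0_le_integral => //.
  - by move=> x _; rewrite fE lee_fin sqr_ge0.
  - under eq_fun do rewrite fE cabs_sqr.
    apply/measurable_EFinP; apply: measurable_funD; apply: measurable_funX;
    exact/measurable_EFinP.
  - move=> x _; rewrite fE lee_fin ler_sqr ?nnegrE ?cabs_ge0//.
by rewrite integral_cst//= probability_setT mule1.
Qed.

Lemma in_L2_trig r (c : s.-tuple int -> R[i]) :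
  uniq r -> in_L2 (trig r c : point R s -> _).
Proof.
move=> ur; have [/measurable_int mR /measurable_int mI] := @cintegrable_trig R s r c.
split; [exact/measurable_EFinP|exact/measurable_EFinP|].
by rewrite L2norm_trig// ltry.
Qed.

Lemma min_error_le Lam (I : finZmodType) (x : I -> point R s)
    (G : seq (s.-tuple int)) (T : R) (n : nat) :
  (forall i, unit_cube (x i)) ->
  (forall d i j, chi d (x (i + j)) = chi d (x i) * chi d (x j)) ->
  uniq G -> {in G &, forall h k, aliased x h k -> h = k} -> 0 < T ->
  (forall B : seq (s.-tuple int), uniq B -> {in B, forall k, k \notin G} ->
     \sum_(k <- B) om k <= T) ->
  (#|I| <= n)%N ->
  (min_error omega a b Lam n s <= (2 * Num.sqrt T)%:E)%E.
Proof.
move=> xc chiM uG sepG T0 BT In.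
pose al := sample_coef x G.
pose A f y := \sum_i al i y * f (x i).
have bound f y : in_H omega a b f -> (Hnorm omega a b f <= 1)%E ->
    cabs (f y - A f y) <= 2 * Num.sqrt T.
  move=> fH f1; have [_ _ fs _] := fH.
  (* The functional f |-> f y - A f y has coefficients of total modulus at most [S]. A polynomial
     within e / S of f at [y] and at all [x i] therefore changes its value by at most [e]. *)
  pose S := 1 + \sum_i cabs (al i y).
  have S0 : 0 < S by rewrite ltr_pwDl// sumr_ge0// => i _; exact: cabs_ge0.
  apply/ler_addgt0Pr => e e0.
  pose p (o : option I) := if o is Some i then x i else y.
  have [C Cp] := fourier_series_approx p fs (divr_gt0 e0 S0).
  pose D := (C `|` [fset h in G])%fset.
  have {}Cp := Cp D (fsubsetUl _ _).
  pose P := trig (enum_fset D) (fourier f) : point R s -> R[i].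
  have PA : P y - A P y = \sum_(k <- enum_fset D)
      fourier f k * (chi k y - \sum_i al i y * chi k (x i)).
    under [RHS]eq_bigr do rewrite mulrBr; rewrite sumrB; congr (_ - _).
    rewrite /A /P /trig; under eq_bigr do rewrite mulr_sumr.
    rewrite exchange_big; apply: eq_bigr => k _; rewrite mulr_sumr.
    by apply: eq_bigr => i _; rewrite mulrCA.
  have PA2 : cabs (P y - A P y) <= 2 * Num.sqrt T.
    rewrite PA; apply: (le_trans (cabs_sum _ _ _)).
    rewrite (bigID (mem G)) /= big1 ?add0r; last first.
      by move=> k kG; rewrite sample_chi_in// subrr mulr0 cabs0.
    rewrite -big_filter; set B := [seq k <- _ | _].
    have uB : uniq B by rewrite filter_uniq// fset_uniq.
    have BG : {in B, forall k, k \notin G} by move=> k; rewrite mem_filter => /andP[].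
    (* A frequency outside [G] costs its own character and at most one alias, hence the factor 2. *)
    apply: (@le_trans _ _ (2 * \sum_(k <- B) cabs (fourier f k))).
      rewrite mulr_sumr; apply: ler_sum => k _; rewrite cabsM mulrC.
      rewrite ler_wpM2r ?cabs_ge0//.
      apply: (le_trans (cabsD _ _)); rewrite cabsN cabs_chi (_ : 2 = 1 + 1)//.
      by rewrite lerD2l; exact: cabs_sample_chi.
    rewrite ler_pM2l// -[leRHS]mul1r.
    by apply: fourier_sum_le => //; exact: BT.
  rewrite (_ : f y - A f y =
    (P y - A P y) - ((P y - f y) - (A P y - A f y))); last by ring.
  apply: (le_trans (cabsD _ _)); rewrite cabsN; apply: lerD => //.
  apply: (le_trans (cabsD _ _)); rewrite cabsN.
  have -> : A P y - A f y = \sum_i al i y * (P (x i) - f (x i)).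
    by rewrite /A -sumrB; apply: eq_bigr => i _; rewrite mulrBr.
  apply: (@le_trans _ _ (e / S + \sum_i cabs (al i y) * (e / S))).
    apply: lerD; first exact: ltW (Cp None).
    apply: (le_trans (cabs_sum _ _ _)); apply: ler_sum => i _.
    by rewrite cabsM ler_wpM2l ?cabs_ge0//; exact: ltW (Cp (Some i)).
  by rewrite -mulr_suml -[X in X + _]mul1r -mulrDl mulrC divfK// gt_eqF.
(* An algorithm must use exactly [n] functionals. Indices from #|I| on are padding: their
   coefficient is 0 and their sample point is [x 0], by the default value of [nth]. *)
pose pt (k : 'I_n) : I := nth 0 (enum I) k.
pose al' (k : 'I_n) : point R s -> R[i] :=
  if (k < #|I|)%N then al (pt k) else fun=> 0.
pose L (k : 'I_n) : functional R s := fun f => f (x (pt k)).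
have algE f y : algorithm al' L f y = A f y.
  rewrite /algorithm /A /al' /L.
  rewrite (eq_bigr (fun k : 'I_n => if (k < #|I|)%N then
    al (nth 0 (enum I) k) y * f (x (nth 0 (enum I) k)) else 0)); last first.
    by move=> k _; case: ifP => //; rewrite mul0r.
  rewrite -big_mkcond /=.
  rewrite -(big_ord_widen n (fun j : nat => al (nth 0 (enum I) j) y *
    f (x (nth 0 (enum I) j))) In) /=.
  rewrite -[RHS]big_enum /= (big_nth 0) -cardE big_mkord.
  by apply: eq_bigr.
apply: (@le_trans _ _ (worst_case_error omega a b (algorithm al' L))).
  apply: ereal_inf_lbound; exists (al', L) => //=; split=> k.
    rewrite /al'; case: ifP => _; first exact: in_L2_trig.
    rewrite (_ : (fun=> 0) = trig [::] (fun=> 0)); first exact: in_L2_trig.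
    by apply/funext => z; rewrite /trig big_nil.
  exact: eval_admissible.
apply: ge_ereal_sup => _ [f [fH f1] <-].
have -> : (fun y => f y - algorithm al' L f y) = (fun y => f y - A f y).
  by apply/funext => y; rewrite algE.
apply: L2norm_le; last by move=> y; exact: bound.
  have -> : (fun y => f y - A f y) =
      (fun y => \sum_i (- f (x i)) * al i y + f y).
    apply/funext => y; rewrite addrC /A -sumrN; congr (_ + _).
    by apply: eq_bigr => i _; rewrite mulNr mulrC.
  apply: cintegrableD; last exact: in_H_cintegrable fH.
  by apply: cintegrable_sum => i _; apply: cintegrableZ; exact: cintegrable_trig.
by rewrite mulr_ge0.
Qed.

End Sampling.

(** * Grids and rank-1 lattices *)

HB.instance Definition _ (I J : finZmodType) := GRing.Zmodule.on (I * J)%type.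

Section SeparatingPoints.
Variable R : realType.

Lemma chi_cons s (d : s.+1.-tuple int) (t : R) (x : point R s) :
  chi d (point_cons (t, x)) =
  cexpi (2 * pi * ((thead d)%:~R * t)) * chi [tuple of behead d] x.
Proof. by rewrite /chi dotp_cons mulrDr cexpiD. Qed.

Lemma cexpi_divn (d : int) (N i : nat) : (0 < N)%N ->
  cexpi (2 * pi * (d%:~R * ((i %% N)%N%:R / N%:R)) : R) =
  cexpi (2 * pi * (d%:~R * (i%:R / N%:R))).
Proof.
move=> N0; have N0' : (N%:R : R) != 0 by rewrite pnatr_eq0 -lt0n.
have -> : (i%:R / N%:R : R) = (i %/ N)%N%:R + (i %% N)%N%:R / N%:R.
  by rewrite [in LHS](divn_eq i N) natrD natrM mulrDl mulfK.
rewrite (mulrDr d%:~R) (mulrDr (2 * pi)) cexpiD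
  (_ : d%:~R * (i %/ N)%:R = (d * (i %/ N)%N)%:~R).
  by rewrite cexpi_int mul1r.
by rewrite intrM.
Qed.

Lemma modn_div_unit (i n : nat) : 0 <= ((i %% n.+1)%N%:R / n.+1%:R : R) <= 1.
Proof.
rewrite divr_ge0//= ler_pdivrMr ?ltr0n// mul1r ler_nat.
by apply: ltnW; rewrite ltn_mod.
Qed.

Definition separating s (G : s.-tuple int -> Prop) (I : finZmodType)
    (x : I -> point R s) : Prop :=
  [/\ forall i, unit_cube (x i),
      forall d i j, chi d (x (i + j)) = chi d (x i) * chi d (x j)
    & forall h k, G h -> G k -> aliased x h k -> h = k].

Lemma chi_at0 s (I : finZmodType) (x : I -> point R s) d :
  (forall d i j, chi d (x (i + j)) = chi d (x i) * chi d (x j)) ->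
  chi d (x 0) = 1.
Proof.
move=> chiM; have := chiM d 0 0; rewrite addr0 => /eqP.
rewrite -subr_eq0 -[X in X - _]mulr1 -mulrBr mulf_eq0 subr_eq0 => /orP[/eqP c0|/eqP//].
by have := cabs_chi d (x 0); rewrite c0 cabs0 => /esym/eqP; rewrite oner_eq0.
Qed.

(** In coordinate j two frequencies of the box differ by at most 2 m_j in modulus. Aliasing makes
    the difference divisible by 2 m_j + 1, so it vanishes. *)
Lemma separating_grid s (m : nat -> nat) :
  exists (I : finZmodType) (x : I -> point R s),
    #|I| = (\prod_(j < s) (m j).*2.+1)%N /\
    separating (fun h => forall j : 'I_s, (`|tnth h j| <= m j)%N) x.
Proof.
elim: s m => [|s IH] m.
  exists 'I_1, (fun=> [tuple]); rewrite card_ord big_ord0; split=> //.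
  split=> [i j|d i j|h k _ _ _]; first by case: j.
    by rewrite /chi /dotp !big_ord0 mulr0 cexpi0 mulr1.
  by rewrite [h]tuple0 [k]tuple0.
have [I [x [cardI [xc xM xS]]]] := IH (fun j => m j.+1).
pose n := (m 0%N).*2.
pose y (p : 'I_n.+1 * I) : point R s.+1 := point_cons (p.1%:R / n.+1%:R, x p.2).
have yM d i j : chi d (y (i + j)) = chi d (y i) * chi d (y j).
  rewrite /y !chi_cons xM /= cexpi_divn// natrD (mulrDl _%:R _%:R).
  rewrite (mulrDr (thead d)%:~R) (mulrDr (2 * pi)) cexpiD.
  by rewrite !mulrA; congr (_ * _); rewrite -!mulrA; congr (_ * _); rewrite mulrC.
exists ('I_n.+1 * I)%type, y; rewrite card_prod card_ord big_ord_recl cardI.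
split=> //; split=> // [[i1 i2] j|h k hm km /forallP hk].
  rewrite (tnth_nth (0 : R)) /=; case: j => -[|j] js /=.
    by rewrite -{1 2}(modn_small (ltn_ord i1)); exact: modn_div_unit.
  have := xc i2 (Ordinal (js : (j < s)%N)).
  by rewrite (tnth_nth (0 : R)).
have hd : thead h = thead k.
  (* If [n] is 0, then ['I_n.+1] has no element 1 and [inord 1] is 0; but then both heads are 0. *)
  have [n0|n0] := posnP n.
    have m0 : m 0%N = 0%N by move: n0; rewrite /n; case: (m 0%N).
    move: (hm ord0) (km ord0); rewrite /thead m0 !leqn0 !absz_eq0.
    by move=> /eqP-> /eqP->.
  have := hk (inord 1, 0); rewrite /y !chi_cons /= !(chi_at0 _ xM) !mulr1.
  rewrite inordK// => /eqP e.
  have : cexpi (2 * pi * ((thead h - thead k)%:~R / n.+1%:R) : R) = 1.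
    rewrite intrB mulrBl (mulrBr (2 * pi)) cexpiD cexpiN.
    by move: e; rewrite mul1r => ->; rewrite mulr_conjc cabs_cexpi expr1n.
  move=> /cexpi_eq1 - /(_ isT); rewrite dvdzE /= => /dvdn_leq.
  have le2 : (`|thead h - thead k| <= n)%N.
    rewrite /n -addnn; have := hm ord0; have := km ord0; rewrite /thead.
    by move: (tnth h ord0) (tnth k ord0) (m 0%N) => u v w; lia.
  case: posnP => [/eqP + _|_ /(_ isT)]; last by rewrite ltnNge le2.
  by rewrite absz_eq0 subr_eq0 => /eqP.
have tl : [tuple of behead h] = [tuple of behead k].
  apply: xS => [j|j|]; [have := hm (lift ord0 j)|have := km (lift ord0 j)|].
  - by rewrite !(tnth_nth 0) /= nth_behead.
  - by rewrite !(tnth_nth 0) /= nth_behead.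
  apply/forallP => i; have := hk (0, i); rewrite /y !chi_cons /=.
  by rewrite mul0r !mulr0 cexpi0 !mul1r.
rewrite (tuple_eta h) (tuple_eta k) hd; apply: val_inj => /=.
by have /= -> := congr1 val tl.
Qed.

(** Measured from the least solution z0, a solution z gives the multiple |d| (z - z0) of N + 1. The
    quotient is less than |d| and determines z. *)
Lemma card_congruence_roots (N : nat) (d c : int) : d != 0 ->
  (#|[set z : 'I_N.+1 | (N.+1 %| (d * (z : nat)%:Z + c)%R)%Z]%SET| <= `|d|)%N.
Proof.
move=> d0; set A := [set z | _]%SET.
have [->|/set0Pn[z1 z1A]] := eqVneq A finset.set0; first by rewrite cards0.
have [z0 z0A z0min] := @arg_minnP _ z1 (mem A) (fun z => nat_of_ord z) z1A.
have dvdA z : z \in A -> (N.+1 %| `|d| * (z - z0))%N.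
  move=> zA; have /= z0z := z0min z zA.
  move: zA z0A; rewrite !inE => zA z0A.
  have := rpredB zA z0A; rewrite opprD addrACA subrr addr0 -mulrBr.
  by rewrite subzn// dvdzE abszM.
have d0' : (0 < `|d|)%N by rewrite absz_gt0.
have fP (z : 'I_N.+1) : (`|d| * (z - z0) %/ N.+1 < `|d|)%N.
  rewrite ltn_divLR// ltn_pmul2l//.
  by apply: leq_ltn_trans (ltn_ord z); exact: leq_subr.
pose f (z : 'I_N.+1) : 'I_`|d| := Ordinal (fP z).
rewrite -[leqRHS]card_ord; apply: (@leq_card_in _ _ f) => u v uA vA [] e.
have := congr1 (muln^~ N.+1) e; rewrite !divnK ?dvdA// => /eqP.
rewrite eqn_pmul2l// => /eqP uv; apply: val_inj => /=.
by have := z0min u uA; have := z0min v vA; rewrite /=; lia.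
Qed.

(* The coordinates of [z] are chosen from the last one to the first: once the
   others are fixed, each [d] with [d_0 != 0] excludes at most [M] of the [N + 1]
   residues for [z_0], and each other [d] is already settled. *)
Lemma exists_generator s (M N : nat) (D : seq (s.-tuple int)) :
  (forall d, d \in D -> d != zero_freq s) ->
  (forall d j, d \in D -> `|tnth d j| <= M)%N ->
  (M * size D < N.+1)%N ->
  exists z : nat -> nat, forall d, d \in D ->
    ~~ (N.+1 %| (\sum_(j < s) tnth d j * (z j)%:Z)%R)%Z.
Proof.
elim: s D => [|s IH] D D0 DM DN.
  exists (fun=> 0%N) => d /D0; by rewrite [d]tuple0 [zero_freq 0]tuple0 eqxx.
pose tl (d : s.+1.-tuple int) : s.-tuple int := [tuple of behead d].
pose D' := [seq d <- map tl D | d != zero_freq s].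
have [||| z' z'P] := IH D'.
- by move=> d; rewrite mem_filter => /andP[].
- move=> d j; rewrite mem_filter => /andP[_ /mapP[e eD ->]].
  have := DM e (lift ord0 j) eD.
  by rewrite !(tnth_nth 0) /= nth_behead.
- apply: leq_ltn_trans DN; rewrite leq_mul2l size_filter; apply/orP; right.
  by apply: (leq_trans (count_size _ _)); rewrite size_map.
pose c d := \sum_(j < s) tnth (tl d) j * (z' j)%:Z.
pose bad d : {set 'I_N.+1} :=
  [set z : 'I_N.+1 | (N.+1 %| (thead d * (z : nat)%:Z + c d)%R)%Z]%SET.
have badM d : d \in D -> (#|bad d| <= M)%N.
  move=> dD; have [d0|d0] := eqVneq (thead d) 0; last first.
    apply: (leq_trans (card_congruence_roots _ _ d0)).
    exact: DM dD.
  rewrite [bad d](_ : _ = finset.set0) ?cards0//; apply/setP => z.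
  rewrite !inE d0 mul0r add0r; apply/negbTE/z'P.
  rewrite mem_filter map_f// andbT; apply: contraNneq (D0 d dD) => tl0.
  rewrite (tuple_eta d) d0; apply/eqP/val_inj => /=.
  by have /= -> := congr1 val tl0.
have cardU : (#|\bigcup_(d <- D) bad d| <= M * size D)%N.
  elim: (D) badM => [|d r IHr] bM; first by rewrite big_nil cards0.
  rewrite big_cons /= mulnS; apply: (leq_trans (leq_card_setU _ _)).
  apply: leq_add; first by apply: bM; rewrite mem_head.
  by apply: IHr => e er; apply: bM; rewrite in_cons er orbT.
have [z zU] : exists z, z \notin (\bigcup_(d <- D) bad d)%SET.
  apply/existsP; rewrite -negb_forall; apply/negP => /forallP zU.
  have : (#|'I_N.+1| <= #|(\bigcup_(d <- D) bad d)%SET|)%N.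
    by apply: subset_leq_card; apply/fintype.subsetP => z _; exact: zU.
  by rewrite card_ord leqNgt (leq_ltn_trans cardU).
exists (fun j : nat => if j is j'.+1 then z' j' else nat_of_ord z) => d dD.
rewrite big_ord_recl /=; apply: contra zU => zd.
rewrite (big_rem d)//= inE; apply/orP; left.
rewrite inE (_ : c d = \sum_(i < s) tnth d (lift ord0 i) * (z' i)%:Z)//.
by apply: eq_bigr => j _; rewrite !(tnth_nth 0) /= nth_behead.
Qed.

(** The non-zero differences of elements of [G] have entries at most 2 M in modulus and number at
    most |G|^2, whence the size of [N]. Frequencies aliased on the lattice generated by z differ by
    some d with d . z = 0 modulo N + 1, which the choice of z excludes for non-zero differences. *)
Lemma separating_lattice s (G : seq (s.-tuple int)) (M N : nat) :
  (forall h j, h \in G -> `|tnth h j| <= M)%N ->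
  (2 * M * size G ^ 2 <= N)%N ->
  exists x : 'I_N.+1 -> point R s, separating (fun h => h \in G) x.
Proof.
move=> GM GN.
pose D := [seq d <- [seq sub_freq h k | h <- G, k <- G] | d != zero_freq s].
have [||| z zP] := @exists_generator s (2 * M) N D.
- by move=> d; rewrite mem_filter => /andP[].
- move=> d j; rewrite mem_filter => /andP[_ /allpairsP[[h k] [hG kG ->]]].
  rewrite tnth_mktuple /=; have := GM h j hG; have := GM k j kG.
  by move: (tnth h j) (tnth k j) => u v; lia.
- rewrite ltnS; apply: leq_trans GN; rewrite leq_mul2l; apply/orP; right.
  by rewrite size_filter (leq_trans (count_size _ _))// size_allpairs mulnn.
pose x (i : 'I_N.+1) : point R s :=
  [tuple ((i * z j) %% N.+1)%N%:R / N.+1%:R | j < s].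
pose dot (d : s.-tuple int) : int := \sum_(j < s) tnth d j * (z j)%:Z.
have chiE d (i : 'I_N.+1) :
    chi d (x i) = cexpi (2 * pi * ((dot d)%:~R * (i%:R / N.+1%:R))).
  rewrite /chi /dotp mulr_sumr cexpi_sum.
  rewrite (eq_bigr (fun j => cexpi (2 * pi *
    ((tnth d j)%:~R * ((i * z j)%N%:R / N.+1%:R))))); last first.
    by move=> j _; rewrite tnth_mktuple cexpi_divn.
  rewrite -cexpi_sum -mulr_sumr; congr (cexpi (_ * _)).
  rewrite /dot rmorph_sum /= mulr_suml; apply: eq_bigr => j _.
  by rewrite intrM natrM -pmulrn mulrA mulrA mulrAC -!mulrA; congr (_ * _); ring.
exists x; split.
- by move=> i j; rewrite tnth_mktuple; exact: modn_div_unit.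
- move=> d i j; rewrite !chiE /= cexpi_divn//.
  rewrite natrD (mulrDl _%:R _%:R) (mulrDr (dot d)%:~R) (mulrDr (2 * pi)).
  by rewrite cexpiD.
move=> h k hG kG /forallP hk; apply/eqP; rewrite -sub_freq_eq0.
apply: contraT => hk0; have dD : sub_freq h k \in D.
  by rewrite mem_filter hk0 allpairs_f.
have /negP[] := zP _ dD; rewrite -/(dot _).
have [N0|N0] := posnP N; first by rewrite N0 dvd1z.
apply: (@cexpi_eq1 R) => //.
have := hk (inord 1); rewrite !chiE inordK// mul1r => /eqP e.
have -> : dot (sub_freq h k) = dot h - dot k.
  by rewrite /dot -sumrB; apply: eq_bigr => j _; rewrite tnth_mktuple mulrBl.
rewrite intrB mulrBl (mulrBr (2 * pi)) cexpiD cexpiN e.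
by rewrite mulr_conjc cabs_cexpi expr1n.
Qed.

End SeparatingPoints.

Lemma box_seq (T : eqType) s (r : nat -> seq T) : (forall j, uniq (r j)) ->
  exists G : seq (s.-tuple T),
    [/\ uniq G, size G = (\prod_(j < s) size (r j))%N &
        forall h, h \in G = [forall j : 'I_s, tnth h j \in r j]].
Proof.
elim: s r => [|s IH] r ur.
  exists [:: [tuple]]; rewrite big_ord0; split=> // h.
  by rewrite [h]tuple0 mem_head; apply/esym/forallP => -[].
have [G [uG sG memG]] := IH (fun j => r j.+1) (fun j => ur j.+1).
exists [seq [tuple of i :: t] | i <- r 0%N, t : s.-tuple T <- G]; split.
- apply: allpairs_uniq => // -[i t] [i' t'] _ _ /= /(congr1 val)/= [-> e].
  by congr pair; exact: val_inj.
- by rewrite size_allpairs big_ord_recl sG.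
move=> h; apply/allpairsP/forallP => [[[i t] [/= ir tG ->]] j|hr].
  move: tG; rewrite memG => /forallP tr.
  have [->|[k ->]] : j = ord0 \/ exists k, j = lift ord0 k.
    case: (unliftP ord0 j) => [k ->|->]; [by right; exists k|by left].
  - by rewrite tnth0.
  - by rewrite tnthS; exact: tr.
exists (thead h, [tuple of behead h]); split => /=; first exact: hr.
  rewrite memG; apply/forallP => j; have := hr (lift ord0 j).
  by rewrite {1}(tuple_eta h) tnthS.
exact: tuple_eta.
Qed.

(** * Error bounds from grids, lattices and boxes *)

Section ErrorBounds.
Variables (R : realType) (omega : R) (a b : nat -> R).
Hypothesis homega : 0 < omega < 1.
Hypothesis a_ge1 : forall j, (1 <= j)%N -> 1 <= a j.
Hypothesis b_ge1 : forall j, (1 <= j)%N -> 1 <= b j.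
Variable Lam : info_class.

Local Notation E := (weight_exponent a b).
Local Notation e_min := (min_error omega a b Lam).
Local Notation om := (omega_h omega a b).

Let w0 : 0 < omega. Proof. by case/andP: homega. Qed.
Let w1 : omega < 1. Proof. by case/andP: homega. Qed.
Let w01 : 0 < omega <= 1. Proof. by rewrite w0 ltW. Qed.

Let wD (x y : R) : omega `^ (x + y) = omega `^ x * omega `^ y.
Proof. by apply: powRD; rewrite (gt_eqF w0) implybT. Qed.

Lemma powR_lt1 (t : R) : 0 < t -> omega `^ t < 1.
Proof. by move=> t0; rewrite /powR gt_eqF// expR_lt1 pmulr_rlt0// ln_lt0. Qed.

(* A bound for the sum of the [omega_h ^ (1/2)] over all frequencies. *)
Definition half_weight_sum (s : nat) : R :=
  \prod_(j < s) (1 + 2 / (1 - omega `^ 2^-1) * omega `^ (2^-1 * a j.+1)).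

Lemma half_weight_sum_ge1 s : 1 <= half_weight_sum s.
Proof.
rewrite /half_weight_sum; elim/big_ind: _ => // [u v u1 v1|j _].
  by rewrite -[leLHS]mulr1 ler_pM.
rewrite lerDl mulr_ge0 ?powR_ge0// divr_ge0// subr_ge0 ltW// powR_lt1//.
Qed.

Lemma tail_sum_le s (X : R) (B : seq (s.-tuple int)) : uniq B ->
  (forall k, k \in B -> X <= E k) ->
  \sum_(k <- B) om k <= omega `^ (X / 2) * half_weight_sum s.
Proof.
move=> uB BX.
have t0 : 0 < 2^-1 :> R by rewrite invr_gt0.
apply: (@le_trans _ _ (omega `^ (X / 2) * \sum_(k <- B) omega `^ (2^-1 * E k))).
  rewrite mulr_sumr big_seq [leRHS]big_seq; apply: ler_sum => k kB.
  rewrite -wD; apply: ger_powR => //.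
  by have := BX k kB; rewrite /weight_exponent; lra.
by rewrite ler_wpM2l ?powR_ge0//; exact: sum_weights_le.
Qed.

Lemma min_error_separating s (I : finZmodType) (x : I -> point R s)
    (Q : s.-tuple int -> Prop) (G : seq (s.-tuple int)) (X : R) (n : nat) :
  separating Q x -> uniq G -> (forall k, k \in G -> Q k) ->
  (forall k, k \notin G -> X <= E k) -> (#|I| <= n)%N ->
  (e_min n s <= (2 * Num.sqrt (half_weight_sum s) * omega `^ (X / 4))%:E)%E.
Proof.
move=> [xc xM xQ] uG GQ GX In.
have W1 := half_weight_sum_ge1 s.
have T0 : 0 < omega `^ (X / 2) * half_weight_sum s.
  by rewrite mulr_gt0 ?powR_gt0// (lt_le_trans ltr01).
have -> : 2 * Num.sqrt (half_weight_sum s) * omega `^ (X / 4) =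
    2 * Num.sqrt (omega `^ (X / 2) * half_weight_sum s).
  rewrite -mulrA sqrtrM ?powR_ge0//; congr (_ * _); rewrite mulrC.
  congr (_ * _); rewrite -powR12_sqrt ?powR_ge0// -powRrM; congr (_ `^ _).
  by field.
apply: (min_error_le homega a_ge1 b_ge1 Lam xc xM uG _ T0) => //.
  by move=> h k hG kG; apply: xQ; exact: GQ.
by move=> B uB BG; apply: tail_sum_le => // k kB; exact: GX (BG k kB).
Qed.

Definition int_range (m : nat) : seq int :=
  [seq Posz i | i <- iota 0 m.+1] ++ [seq Negz i | i <- iota 0 m].

Lemma uniq_int_range m : uniq (int_range m).
Proof.
rewrite cat_uniq !map_inj_uniq ?iota_uniq ?andbT//; try by move=> ? ? [].
by apply/hasPn => _ /mapP[n _ ->]; apply/negP => /mapP[].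
Qed.

Lemma mem_int_range m i : (i \in int_range m) = (`|i| <= m)%N.
Proof.
rewrite mem_cat; case: i => n.
  rewrite (mem_map (f := Posz)) ?mem_iota; last by move=> ? ? [].
  rewrite (_ : (Posz n \in _) = false) ?orbF ?add0n ?ltnS//.
  by apply/negP => /mapP[].
rewrite (mem_map (f := Negz)) ?mem_iota; last by move=> ? ? [].
rewrite (_ : (Negz n \in _) = false) ?add0n//.
by apply/negP => /mapP[].
Qed.

Lemma weight_term_le s (k : s.-tuple int) (j : 'I_s) :
  a j.+1 * ((`|tnth k j|%N)%:R `^ b j.+1) <= E k.
Proof.
rewrite /weight_exponent (bigD1 j)//= lerDl; apply: sumr_ge0 => i _.
by rewrite mulr_ge0 ?powR_ge0// (le_trans ler01)// a_ge1.
Qed.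

(** A frequency outside the box has some |k_j| >= m_j + 1, and this single term already gives E(k)
    >= X. *)
Lemma min_error_grid s (m : nat -> nat) (X : R) (n : nat) :
  (forall j, (j < s)%N -> X <= a j.+1 * ((m j).+1%:R `^ b j.+1)) ->
  (\prod_(j < s) (m j).*2.+1 <= n)%N ->
  (e_min n s <= (2 * Num.sqrt (half_weight_sum s) * omega `^ (X / 4))%:E)%E.
Proof.
move=> mX mn; have [I [x [cardI sep]]] := separating_grid R s m.
have [G [uG _ memG]] := @box_seq _ s (fun j => int_range (m j))
  (fun j => uniq_int_range (m j)).
apply: (min_error_separating sep uG) => [k|k|]; last by rewrite cardI.
  by rewrite memG => /forallP kr j; have := kr j; rewrite mem_int_range.
rewrite memG negb_forall => /existsP[j]; rewrite mem_int_range -ltnNge => mk.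
apply: le_trans (weight_term_le k j); apply: (le_trans (mX j (ltn_ord j))).
rewrite ler_pM2l; last by rewrite (lt_le_trans ltr01)// a_ge1.
by apply: ge0_ler_powR; rewrite ?nnegrE// ?ler_nat// (le_trans ler01)// b_ge1.
Qed.

(** Places {E <= X} in the cube of radius [Num.truncn X], which makes it finite and supplies the
    bound M for the lattice. *)
Lemma abs_le_weight s (k : s.-tuple int) (j : 'I_s) :
  (`|tnth k j|%N)%:R <= E k.
Proof.
apply: le_trans (weight_term_le k j).
apply: (le_trans (@powR_ge_id _ _ _ (b_ge1 (ltn0Sn j)))).
by rewrite ler_peMl ?powR_ge0// a_ge1.
Qed.

(* [m] counts the frequencies with [E <= X]; its bound is Markov's inequality for
   the sum of the [omega_h ^ t]. *)
Lemma min_error_lattice s (X t : R) : 0 <= X -> 0 < t ->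
  exists m : nat, [/\ (0 < m)%N,
    m%:R <= omega `^ (- (t * X)) *
      \prod_(j < s) (1 + 2 / (1 - omega `^ t) * omega `^ (t * a j.+1)) &
    (e_min (2 * Num.truncn X * m ^ 2).+1 s <=
       (2 * Num.sqrt (half_weight_sum s) * omega `^ (X / 4))%:E)%E].
Proof.
move=> X0 t0.
have [G0 [uG0 _ memG0]] := @box_seq _ s (fun=> int_range (Num.truncn X))
  (fun=> uniq_int_range _).
pose G := [seq k <- G0 | E k <= X].
have uG : uniq G by exact: filter_uniq.
have memG k : (k \in G) = (E k <= X).
  rewrite mem_filter andb_idr// => kX; rewrite memG0; apply/forallP => j.
  by rewrite mem_int_range truncn_ge_nat// (le_trans (abs_le_weight k j)).
exists (size G); split.
- have : zero_freq s \in G.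
    rewrite memG /weight_exponent big1// => j _.
    rewrite tnth_zero_freq powR0 ?mulr0// gt_eqF// (lt_le_trans ltr01)//.
    exact: b_ge1.
  by case: (G).
- have := sum_weights_le homega a_ge1 b_ge1 t0 uG.
  rewrite powRN -ler_pdivrMl ?invr_gt0 ?powR_gt0// invrK; apply: le_trans.
  rewrite -sum1_size natr_sum mulr_sumr big_seq [leRHS]big_seq.
  apply: ler_sum => k; rewrite memG mulr1 => kX.
  by apply: ger_powR => //; rewrite ler_pM2l.
have [|x sep] := @separating_lattice R s G (Num.truncn X)
    (2 * Num.truncn X * size G ^ 2) _ (leqnn _).
  move=> h j; rewrite memG => hX.
  by rewrite truncn_ge_nat// (le_trans (abs_le_weight h j)).
apply: (min_error_separating sep uG) => // [k|]; last by rewrite card_ord.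
by rewrite memG -ltNge => /ltW.
Qed.

Lemma min_error_box s (r : nat -> seq int) (Y : R) (n : nat) :
  (forall j, uniq (r j)) -> (n < \prod_(j < s) size (r j))%N ->
  (forall h : s.-tuple int, (forall j : 'I_s, tnth h j \in r j) -> E h <= Y) ->
  ((omega `^ (Y / 2))%:E <= e_min n s)%E.
Proof.
move=> ur nr hY; have [G [uG sG memG]] := @box_seq _ s r ur.
apply: (min_error_ge homega Lam uG); rewrite ?sG ?powR_ge0// => h.
rewrite memG => /forallP hr; rewrite -powR_mulrn ?powR_ge0// -powRrM.
apply: ger_powR => //; have := hY h hr; rewrite /weight_exponent; lra.
Qed.

End ErrorBounds.

(** * Convergence rates and information complexity *)

Lemma powR_unbounded (R : realType) (e A D Y0 : R) : 0 < e -> 0 < A ->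
  exists Y, [/\ 1 <= Y, Y0 <= Y & D < A * Y `^ e].
Proof.
move=> e0 A0; pose y := ((`|D| + 1) / A) `^ e^-1.
have D1 : 0 < `|D| + 1 by rewrite ltr_wpDl.
exists (Num.max 1 (Num.max Y0 y)); rewrite !le_max !lexx ?orbT; split=> //.
rewrite -ltr_pdivrMl// mulrC; apply: (@lt_le_trans _ _ ((`|D| + 1) / A)).
  by rewrite ltr_pM2r ?invr_gt0// ltr_pwDr// ler_norm.
have -> : (`|D| + 1) / A = y `^ e.
  by rewrite /y -powRrM mulVf ?gt_eqF// powRr1// ltW// divr_gt0.
apply: ge0_ler_powR; rewrite ?nnegrE ?powR_ge0//; first exact: ltW.
  by rewrite le_max ler01.
by rewrite !le_max lexx !orbT.
Qed.

Lemma ler_powR_base (R : realType) (x y r : R) :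
  0 <= r -> 0 <= x -> x <= y -> x `^ r <= y `^ r.
Proof.
move=> r0 x0 xy; apply: ge0_ler_powR; rewrite ?nnegrE//; exact: le_trans xy.
Qed.

Section Rates.
Variables (R : realType) (omega : R) (a b : nat -> R).
Hypothesis homega : 0 < omega < 1.
Hypothesis a_ge1 : forall j, (1 <= j)%N -> 1 <= a j.
Hypothesis b_ge1 : forall j, (1 <= j)%N -> 1 <= b j.
Variable Lam : info_class.

Local Notation E := (weight_exponent a b).
Local Notation e_min := (min_error omega a b Lam).
Local Notation W := (half_weight_sum omega a).

Let w0 : 0 < omega. Proof. by case/andP: homega. Qed.
Let w01 : 0 < omega <= 1.
Proof. by rewrite w0 ltW//; case/andP: homega. Qed.

Let aS_gt0 j : 0 < a j.+1. Proof. exact: lt_le_trans (a_ge1 _). Qed.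
Let bS_gt0 j : 0 < b j.+1. Proof. exact: lt_le_trans (b_ge1 _). Qed.
Let bSV_gt0 j : 0 < (b j.+1)^-1. Proof. by rewrite invr_gt0. Qed.

Lemma BsumE s : Bsum b s = \sum_(j < s) (b j.+1)^-1.
Proof. by rewrite /Bsum big_add1 big_mkord. Qed.

Lemma Bsum_gt0 s : (0 < s)%N -> 0 < Bsum b s.
Proof.
case: s => // s _; rewrite BsumE big_ord_recl ltr_pwDl//.
by apply: sumr_ge0 => j _; exact: ltW.
Qed.

Lemma powR_Bsum s (x : R) : 0 < x ->
  x `^ Bsum b s = \prod_(j < s) x `^ (b j.+1)^-1.
Proof. by move=> x0; rewrite BsumE powR_sum. Qed.

(** The number of coordinates in which the grid adapted to X has more than one point: if a_j > X,
    every frequency with k_j <> 0 has E(k) > X. *)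
Definition active_count (s : nat) (X : R) : nat :=
  (\sum_(j < s) (a j.+1 <= X)%R)%N.

(** With x = (X / a_j)^(1/b_j), coordinate j needs 2 floor(x) + 1 points. This is at most 3 x <= 3
    X^(1/b_j) if a_j <= X, and equals 1 otherwise. *)
Lemma min_error_grid_powR s (X : R) (n : nat) : 1 <= X ->
  3 ^+ active_count s X * X `^ Bsum b s <= n%:R ->
  (e_min n s <= (2 * Num.sqrt (W s) * omega `^ (X / 4))%:E)%E.
Proof.
move=> X1 Xn; have X0 : 0 < X by exact: lt_le_trans X1.
pose m j := Num.truncn ((X / a j.+1) `^ (b j.+1)^-1).
apply: (@min_error_grid _ _ _ _ homega a_ge1 b_ge1 Lam s m).
  move=> j _; rewrite -ler_pdivrMl//.
  have Xa0 : 0 <= X / a j.+1 by rewrite divr_ge0// ltW.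
  have -> : (a j.+1)^-1 * X = ((X / a j.+1) `^ (b j.+1)^-1) `^ b j.+1.
    by rewrite -powRrM mulVf ?gt_eqF// powRr1// mulrC.
  apply: ler_powR_base; rewrite ?powR_ge0//; first exact: ltW.
  exact/ltW/truncnS_gt.
rewrite -(@ler_nat R); apply: le_trans Xn.
rewrite powR_Bsum// /active_count -prodrXr natr_prod -big_split /=.
apply: ler_prod => j _; rewrite ler0n/=.
set x := (X / a j.+1) `^ (b j.+1)^-1.
have x0 : 0 <= x by exact: powR_ge0.
have [aX|Xa] := leP (a j.+1) X; last first.
  rewrite mul1r [m j](_ : _ = 0%N); last first.
    apply/truncn0Pn; rewrite -ltNge /x.
    rewrite -[ltRHS](powRr0 (X / a j.+1)).
    rewrite /powR gt_eqF ?divr_gt0// ltr_expR mul0r pmulr_rlt0//.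
    by rewrite ln_lt0// divr_gt0//= ltr_pdivrMr// mul1r.
  by rewrite -[leLHS](powRr0 X) ler_powR// ltW.
have x1 : 1 <= x.
  rewrite -[leLHS](powRr0 (X / a j.+1)) ler_powR//; last exact: ltW.
  by rewrite ler_pdivlMr// mul1r.
have mx : (m j)%:R <= x by rewrite truncn_le.
apply: (@le_trans _ _ (3 * x)).
  by rewrite -addn1 -muln2 natrD natrM; lra.
rewrite expr1 ler_pM2l//; apply: ler_powR_base; first exact: ltW.
  by rewrite divr_ge0// ltW.
by rewrite ler_pdivrMr// ler_peMr// ?a_ge1// ltW.
Qed.

Lemma active_count_le s X : (active_count s X <= s)%N.
Proof.
rewrite /active_count -[leqRHS]card_ord -sum1_card; apply: leq_sum => j _.
exact: leq_b1.
Qed.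

(** The choice X = (n / 3^s)^p solves 3^s X^(1/p) = n, and B(s) <= 1/p. Counting all coordinates as
    active affects only C_1(s). *)
Lemma min_error_exp (n s : nat) (p : R) : (0 < n)%N -> 0 < p ->
  p * Bsum b s <= 1 -> (e_min n s <=
   (2 * Num.sqrt (W s) * (omega `^ 4^-1) `^ ((n%:R / 3 ^+ s) `^ p))%:E)%E.
Proof.
move=> n0 p0 pB; set X := (_ / _) `^ p.
have X0 : 0 <= X by exact: powR_ge0.
have W0 : 0 <= 2 * Num.sqrt (W s) by rewrite mulr_ge0.
have -> : (omega `^ 4^-1) `^ X = omega `^ (X / 4) by rewrite -powRrM mulrC.
have s0 : 0 < 3 ^+ s :> R by rewrite exprn_gt0.
(* The grid estimate asks for X >= 1. Below that one sample point is enough: since a_j >= 1, every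
   non-zero frequency has E >= 1, which gives the bound belonging to X = 1. *)
have [X1|X1] := leP X 1.
  apply: (@le_trans _ _ (2 * Num.sqrt (W s) * omega `^ (1 / 4))%:E).
    apply: (@min_error_grid _ _ _ _ homega a_ge1 b_ge1 Lam s (fun=> 0%N)).
      by move=> j _; rewrite powR1 mulr1 a_ge1.
    by rewrite big1.
  by rewrite lee_fin ler_wpM2l// ger_powR// ler_pM2r.
apply: min_error_grid_powR; first exact: ltW.
have XB : X `^ Bsum b s <= n%:R / 3 ^+ s.
  have -> : n%:R / 3 ^+ s = X `^ p^-1.
    by rewrite /X -powRrM mulfV ?gt_eqF// powRr1// divr_ge0// ltW.
  by apply: ler_powR; [exact: ltW|rewrite -[p^-1]mul1r ler_pdivlMr// mulrC].
apply: (@le_trans _ _ (3 ^+ s * X `^ Bsum b s)).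
  rewrite ler_wpM2r ?powR_ge0//; apply: ler_weXn2l; last exact: active_count_le.
  by rewrite ler1n.
by rewrite -ler_pdivlMl// mulrC.
Qed.

Lemma exp_bound_exists (p : nat -> R) :
  (forall s, (0 < s)%N -> 0 < p s /\ p s * Bsum b s <= 1) ->
  exists q C C1, exp_bound omega a b Lam q p C C1.
Proof.
move=> pB; exists (omega `^ 4^-1), (fun s => 2 * Num.sqrt (W s)), (fun s => 3 ^+ s).
split.
- by rewrite powR_gt0//= powR_lt1// invr_gt0.
- move=> s s0; split; [by have [] := pB s s0| |by rewrite exprn_gt0].
  by rewrite mulr_gt0// sqrtr_gt0 (lt_le_trans ltr01)// half_weight_sum_ge1.
- by move=> n s n0 s0; have [p0 pB1] := pB s s0; exact: min_error_exp.
Qed.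

(* [count_coef s * Y ^ Bsum b s] bounds from below the number of [h >= 0] with
   [a_j h_j ^ b_j <= Y / s] for all [j]. *)
Definition count_coef (s : nat) : R :=
  \prod_(j < s) ((s%:R * a j.+1)^-1) `^ (b j.+1)^-1.

Lemma count_coef_gt0 s : (0 < s)%N -> 0 < count_coef s.
Proof.
move=> s0; apply: prodr_gt0 => j _.
by rewrite powR_gt0// invr_gt0 mulr_gt0// ltr0n.
Qed.

Lemma min_error_count (n s : nat) (Y : R) : (0 < s)%N -> 0 < Y ->
  n%:R < count_coef s * Y `^ Bsum b s ->
  ((omega `^ (Y / 2))%:E <= e_min n s)%E.
Proof.
move=> s0 Y0 nY; have sR : 0 < s%:R :> R by rewrite ltr0n.
pose y j := (Y / (s%:R * a j.+1)) `^ (b j.+1)^-1.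
pose r j := [seq Posz i | i <- iota 0 (Num.truncn (y j)).+1].
have y0 j : 0 <= y j by exact: powR_ge0.
apply: (@min_error_box _ _ _ _ homega Lam s r).
- by move=> j; rewrite map_inj_uniq ?iota_uniq// => ? ? [].
- rewrite -(@ltr_nat R); apply: (lt_le_trans nY).
  rewrite powR_Bsum// /count_coef -big_split natr_prod /=.
  apply: ler_prod => j _; rewrite mulr_ge0 ?powR_ge0//=.
  rewrite size_map size_iota -powRM; last 2 first.
  - by rewrite invr_ge0 mulr_ge0// ltW.
  - exact: ltW.
  by rewrite mulrC; exact/ltW/truncnS_gt.
move=> h hr; apply: (@le_trans _ _ (\sum_(j < s) Y / s%:R)); last first.
  by rewrite sumr_const card_ord -[leLHS]mulr_natr divfK// gt_eqF.
apply: ler_sum => j _; have /mapP[i ir ->] := hr j.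
rewrite absz_nat -ler_pdivlMl//.
have iy : i%:R <= y j.
  move: ir; rewrite mem_iota add0n ltnS => /andP[_].
  by rewrite truncn_ge_nat.
apply: (@le_trans _ _ (y j `^ b j.+1)).
  by apply: ler_powR_base => //; exact: ltW.
rewrite /y -powRrM mulVf ?gt_eqF// powRr1.
  by rewrite invfM mulrA mulrC.
by apply: divr_ge0; [exact: ltW|rewrite mulr_ge0// ltW].
Qed.

(** Compare logarithms at n about z(Y) / 2, where the error is at least omega^(Y/2). The logarithm
    of the lower bound is linear in Y, that of the assumed upper bound is at most ln C(s) - A Y^(p
    B(s)). With p B(s) > 1 the latter is smaller for large Y. *)
Lemma exp_bound_exponent (q : R) (p C C1 : nat -> R) (s : nat) : (0 < s)%N ->
  exp_bound omega a b Lam q p C C1 -> p s * Bsum b s <= 1.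
Proof.
move=> s0 [/andP[q0 q1] pC eb]; have [p0 C0 C10] := pC s s0.
have cs := count_coef_gt0 s0; have B0 := Bsum_gt0 s0.
rewrite leNgt; apply/negP => pB.
pose z Y := count_coef s * Y `^ Bsum b s.
pose e := p s * Bsum b s - 1; have e0 : 0 < e by rewrite subr_gt0.
(* [A] and [D] are the competing growth constants: n >= z(Y) / 4 gives - ln q (n / C_1)^p >= A Y^(p
   B(s)), and for Y >= 1 the other terms, ln C(s) - (Y/2) ln omega, are at most D Y. *)
pose A := - ln q * (count_coef s / (4 * C1 s)) `^ p s : R.
have A0 : 0 < A.
  rewrite mulr_gt0 ?powR_gt0 ?divr_gt0 ?mulr_gt0// oppr_gt0.
  by rewrite ln_lt0// q0.
pose D := `|ln (C s)| - ln omega / 2 : R.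
(* The lower bound on [Y] gives [z Y >= 4], so that the integer part of
   [z Y / 2] is at least [z Y / 4]. *)
have [Y [Y1 YY0 DY]] :=
  @powR_unbounded R e A D ((4 / count_coef s) `^ (Bsum b s)^-1) e0 A0.
have Yp : 0 < Y by exact: lt_le_trans Y1.
have z4 : 4 <= z Y.
  rewrite /z -ler_pdivrMl// mulrC.
  have -> : 4 / count_coef s = ((4 / count_coef s) `^ (Bsum b s)^-1) `^ Bsum b s.
    by rewrite -powRrM mulVf ?gt_eqF// powRr1// divr_ge0// ltW.
  by apply: ler_powR_base => //; [exact: ltW|exact: powR_ge0].
pose n := Num.truncn (z Y / 2).
have /andP[nz zn] : n%:R <= z Y / 2 < n.+1%:R by apply: truncn_itv; lra.
have zn4 : z Y / 4 <= n%:R by move: zn; rewrite -(natr1 n); lra.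
have n0 : (0 < n)%N by rewrite -(@ltr_nat R); lra.
have lo : ((omega `^ (Y / 2))%:E <= e_min n s)%E.
  by apply: min_error_count => //; rewrite -/(z Y); lra.
have := le_trans lo (eb n s n0 s0); rewrite lee_fin.
rewrite -ler_ln ?posrE ?mulr_gt0 ?powR_gt0// lnM ?posrE ?powR_gt0// !ln_powR.
apply/negP; rewrite -ltNge.
have lnq : ln q < 0 by rewrite ln_lt0// q0.
have h1 : (n%:R / C1 s) `^ p s * - ln q >= A * Y `^ (p s * Bsum b s).
  have -> : A * Y `^ (p s * Bsum b s) = (z Y / 4 / C1 s) `^ p s * - ln q.
    rewrite /A (_ : z Y / 4 / C1 s =
      (count_coef s / (4 * C1 s)) * Y `^ Bsum b s); last first.
      by rewrite /z; field; rewrite gt_eqF.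
    have c0 : 0 <= count_coef s / (4 * C1 s).
      by rewrite divr_ge0 ?mulr_ge0// ltW.
    rewrite [in RHS](powRM _ c0) ?powR_ge0// [p s * _]mulrC powRrM.
    by ring.
  apply: ler_wpM2r; first by rewrite oppr_ge0 ltW.
  apply: ler_powR_base; first exact: ltW.
    by apply: divr_ge0; [lra|exact: ltW].
  by rewrite ler_pM2r ?invr_gt0.
have h2 : Y * D < A * Y `^ (p s * Bsum b s).
  have -> : A * Y `^ (p s * Bsum b s) = Y * (A * Y `^ e).
    have -> : p s * Bsum b s = 1 + e by rewrite /e addrC subrK.
    by rewrite powRD ?(gt_eqF Yp) ?implybT// powRr1 ?(ltW Yp)// mulrCA.
  by rewrite ltr_pM2l.
have h3 : ln (C s) - Y / 2 * ln omega <= Y * D.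
  rewrite /D mulrBr; have := ler_norm (ln (C s)).
  have : `|ln (C s)| <= Y * `|ln (C s)| by rewrite ler_peMl.
  lra.
lra.
Qed.

End Rates.

(** Apply ln y < y to y = d x, with d so small that B d <= e / 2; [x0] is large enough for the
    constants to be at most e x / 2. *)
Lemma affine_ln_le (R : realType) (A B e : R) : 0 < e -> 0 <= B ->
  exists2 x0 : R, 1 <= x0 & forall x, x0 <= x -> A + B * ln x <= e * x.
Proof.
move=> e0 B0; pose d := e / (2 * (B + 1)).
have B1 : 0 < B + 1 by rewrite ltr_wpDl.
have d0 : 0 < d by rewrite divr_gt0// mulr_gt0.
pose K := `|A| + B * `|ln d| : R.
exists (1 + 2 * K / e) => [|x xK].
  by rewrite lerDl divr_ge0 ?(ltW e0)// mulr_ge0// addr_ge0// mulr_ge0.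
have K0 : 0 <= K by rewrite addr_ge0// mulr_ge0.
have x0 : 0 < x.
  apply: lt_le_trans xK; rewrite ltr_pwDl// divr_ge0 ?(ltW e0)//.
  by rewrite mulr_ge0.
have lnx : ln x <= d * x - ln d.
  have : ln (d * x) <= d * x.
    by apply: (le_trans (ltW (ln_sublinear _))) => //; rewrite mulr_gt0.
  by rewrite lnM ?posrE//; lra.
have h1 : B * ln x <= B * (d * x) + B * `|ln d|.
  rewrite -mulrDr ler_wpM2l//; apply: (le_trans lnx); rewrite lerD2l.
  by rewrite -normrN ler_norm.
have h2 : B * (d * x) <= e * x / 2.
  have dB : d * (B + 1) = e / 2 by rewrite /d; field; rewrite gt_eqF.
  have dx : 0 < d * x by rewrite mulr_gt0.
  have -> : B * (d * x) = d * (B + 1) * x - d * x by ring.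
  rewrite dB; lra.
have h3 : K <= e * x / 2.
  have : 2 * K / e <= x by apply: le_trans xK; rewrite lerDr.
  by rewrite ler_pdivrMr//; lra.
have := ler_norm A; rewrite /K in h3; lra.
Qed.

Lemma sum_ltn_le (s K : nat) : (\sum_(j < s) (j < K)%N <= K)%N.
Proof.
rewrite -(big_mkord xpredT (fun j => nat_of_bool (j < K)%N)) /=.
elim: s => [|s IH]; first by rewrite big_geq.
rewrite big_nat_recr//=; case: (ltnP s K) => sK; last by rewrite addn0.
rewrite addn1; apply: leq_ltn_trans sK.
apply: (@leq_trans (\sum_(0 <= j < s) 1)); last by rewrite sum_nat_const_nat subn0 muln1.
by apply: leq_sum => j _; exact: leq_b1.
Qed.

(** * Lower and upper bounds for the information complexity *)

Section Complexity.
Variables (R : realType) (omega : R) (a b : nat -> R).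
Hypothesis homega : 0 < omega < 1.
Hypothesis a_ge1 : forall j, (1 <= j)%N -> 1 <= a j.
Hypothesis b_ge1 : forall j, (1 <= j)%N -> 1 <= b j.
Variable Lam : info_class.

Local Notation e_min := (min_error omega a b Lam).
Local Notation info := (info_complexity omega a b Lam).
Local Notation W := (half_weight_sum omega a).
Local Notation w := (- ln omega).

Let w0 : 0 < omega. Proof. by case/andP: homega. Qed.
Let w1 : omega < 1. Proof. by case/andP: homega. Qed.
Let w01 : 0 < omega <= 1. Proof. by rewrite w0 ltW. Qed.

Lemma neg_ln_gt0 : 0 < w. Proof. by rewrite oppr_gt0 ln_lt0. Qed.

Let wlt (x y : R) : x < y -> omega `^ y < omega `^ x.
Proof.
by move=> xy; rewrite /powR gt_eqF// ltr_expR ltr_nM2r// ln_lt0.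
Qed.

Lemma info_complexity_le (n s : nat) (eps : R) :
  (e_min n s <= eps%:E)%E -> (info eps s <= n%:R%:E)%E.
Proof. by move=> en; apply: ereal_inf_lbound; exists n. Qed.

Lemma info_complexity_ge (z eps : R) (s : nat) :
  (forall n : nat, n%:R < z -> (eps%:E < e_min n s)%E) ->
  (z%:E <= info eps s)%E.
Proof.
move=> zP; apply: le_ereal_inf_tmp => _ [n /= en <-]; rewrite lee_fin leNgt.
by apply/negP => /zP; rewrite ltNge en.
Qed.

Lemma info_complexity_value eps s :
  info eps s = +oo%E \/ exists n : nat, info eps s = n%:R%:E.
Proof.
pose S := [set n : nat | (e_min n s <= eps%:E)%E].
have [[n0 Sn0]|S0] := pselect (exists n, S n); last first.
  left; rewrite /info_complexity (_ : [set _ | n in _] = set0) ?ereal_inf0//.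
  by rewrite -subset0 => y [n Sn _]; apply: S0; exists n.
have exS : exists n, `[< S n >] by exists n0; exact/asboolP.
right; exists (ex_minn exS); case: ex_minnP => n /asboolP Sn nmin.
apply/eqP; rewrite eq_le; apply/andP; split; first exact: info_complexity_le.
apply: le_ereal_inf_tmp => _ [k /= Sk <-]; rewrite lee_fin ler_nat.
by apply: nmin; exact/asboolP.
Qed.

Lemma eps_powR (Y : R) : 0 < Y -> 0 < omega `^ Y < 1.
Proof. by move=> Y0; rewrite powR_gt0//= powR_lt1. Qed.

Lemma ln_eps_powR (Y : R) : ln (omega `^ Y)^-1 = Y * w.
Proof. by rewrite -powRN ln_powR mulNr mulrN. Qed.

(** Accuracy omega^Y lies strictly below the error bound omega^(Y/2), as is needed to exclude every
    such n. *)
Lemma info_complexity_count (s : nat) (Y : R) : (0 < s)%N -> 0 < Y ->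
  ((count_coef a b s * Y `^ Bsum b s)%:E <= info (omega `^ Y) s)%E.
Proof.
move=> s0 Y0; apply: info_complexity_ge => n nY.
apply: (lt_le_trans _ (min_error_count homega a_ge1 b_ge1 Lam s0 Y0 nY)).
by rewrite lte_fin; apply: wlt; lra.
Qed.

Lemma info_complexity_cube (s : nat) (Y : R) : 0 < Y ->
  \sum_(j < s) a j.+1 <= Y -> ((3 ^+ s)%:E <= info (omega `^ Y) s)%E.
Proof.
move=> Y0 aY; apply: info_complexity_ge => n; rewrite -natrX ltr_nat => n3.
apply: (@lt_le_trans _ _ (omega `^ (Y / 2))%:E).
  by rewrite lte_fin; apply: wlt; lra.
apply: (@min_error_box _ _ _ _ homega Lam s (fun=> int_range 1)).
- by move=> j; exact: uniq_int_range.
- by rewrite prod_nat_const card_ord.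
move=> h hr; apply: le_trans aY; apply: ler_sum => j _.
rewrite -[leRHS]mulr1; apply: ler_wpM2l; first by rewrite (le_trans ler01) ?a_ge1.
have := hr j; rewrite mem_int_range.
case: (`|tnth h j|%N) => [|[|//]] _; last by rewrite powR1.
by rewrite powR0// gt_eqF// (lt_le_trans ltr01)// b_ge1.
Qed.

(** In a fixed dimension and at accuracy omega^Y, the complexity grows at least like Y^(B(s)), the
    assumed bound like Y^tau. As [K] may depend on s, the factor s^tau1 of polynomial tractability
    fits into it. *)
Lemma Bsum_le_exponent (s : nat) (K tau : R) : (0 < s)%N -> 0 <= tau ->
  (forall eps, 0 < eps < 1 ->
     (info eps s <= (K * (1 + ln eps^-1) `^ tau)%:E)%E) ->
  Bsum b s <= tau.
Proof.
move=> s0 t0 infoK; rewrite leNgt; apply/negP => tB.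
have c0 : 0 < count_coef a b s by exact: count_coef_gt0.
have [|Y [Y1 _ YK]] :=
  @powR_unbounded R (Bsum b s - tau) (count_coef a b s)
  (`|K| * (1 + w) `^ tau) 0 _ c0; first by rewrite subr_gt0.
have Y0 : 0 < Y by exact: lt_le_trans Y1.
have wp := neg_ln_gt0.
have := le_trans (info_complexity_count s0 Y0) (infoK _ (eps_powR Y0)).
rewrite lee_fin ln_eps_powR; apply/negP; rewrite -ltNge.
have h1 : (1 + Y * w) `^ tau <= (1 + w) `^ tau * Y `^ tau.
  rewrite -powRM; [|by rewrite addr_ge0// ltW|exact: ltW].
  apply: ler_powR_base => //; first by rewrite addr_ge0// mulr_ge0// ltW.
  by rewrite mulrDl mul1r [w * Y]mulrC lerD2r.
have h2 : K * (1 + Y * w) `^ tau <= `|K| * ((1 + w) `^ tau * Y `^ tau).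
  apply: (@le_trans _ _ (`|K| * (1 + Y * w) `^ tau)).
    by rewrite ler_wpM2r ?powR_ge0// ler_norm.
  by rewrite ler_wpM2l.
apply: (le_lt_trans h2).
have -> : Y `^ Bsum b s = Y `^ (Bsum b s - tau) * Y `^ tau.
  by rewrite -powRD ?subrK// (gt_eqF Y0) implybT.
by rewrite !mulrA ltr_pM2r ?powR_gt0.
Qed.

(** The cube in dimension J at accuracy omega^(J a_J) gives 3^J <= c J^tau1 (1 + J a_J w)^tau2,
    where w = - ln omega. Take logarithms and divide by J: everything except ln 3 and tau2 (ln a_J)
    / J tends to 0. *)
Lemma ln_weight_ge (c tau1 tau2 e : R) : 0 < e -> 0 <= c -> 0 <= tau1 ->
  0 <= tau2 -> (forall j, (1 <= j)%N -> a j <= a j.+1) ->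
  (forall s eps, (0 < s)%N -> 0 < eps < 1 -> (info eps s <=
     (c * s%:R `^ tau1 * (1 + ln eps^-1) `^ tau2)%:E)%E) ->
  exists J0 : nat, forall J : nat, (J0 <= J)%N ->
    ln 3 - e <= tau2 * (ln (a J) / J%:R).
Proof.
move=> e0 c0 t10 t20 a_mono infoK; have wp := neg_ln_gt0.
have [x0 x01 x0P] := affine_ln_le (ln c + tau2 * ln (1 + w)) e0 (addr_ge0 t10 t20).
exists (Num.truncn x0).+1 => J J0J.
have J1 : (1 <= J)%N by exact: leq_trans J0J.
have Jp : 0 < J%:R :> R by rewrite ltr0n.
have Jge1 : 1 <= J%:R :> R by rewrite ler1n.
have aJ : 1 <= a J by exact: a_ge1.
have x0J : x0 <= J%:R.
  by apply: (le_trans (ltW (truncnS_gt x0))); rewrite ler_nat.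
have a_le i : (1 <= i <= J)%N -> a i <= a J.
  elim: J {J0J J1 Jp Jge1 aJ x0J} => [|J IH]; first by case: i.
  move=> /andP[i1]; rewrite leq_eqVlt => /predU1P[->//|iJ].
  apply: (@le_trans _ _ (a J)); first by apply: IH; rewrite i1.
  by apply: a_mono; exact: leq_trans i1 iJ.
pose Y := J%:R * a J.
have Y1 : 1 <= Y by rewrite -[leLHS]mulr1 ler_pM.
have Y0 : 0 < Y by exact: lt_le_trans Y1.
have aY : \sum_(j < J) a j.+1 <= Y.
  apply: (@le_trans _ _ (\sum_(j < J) a J)).
    by apply: ler_sum => j _; apply: a_le; rewrite ltn_ord.
  by rewrite sumr_const card_ord /Y mulr_natl.
have := le_trans (info_complexity_cube Y0 aY) (infoK J _ J1 (eps_powR Y0)).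
rewrite lee_fin ln_eps_powR => h3.
have Yw : 0 < 1 + Y * w by rewrite ltr_pwDl// mulr_ge0// ltW.
have c1 : 0 < c.
  rewrite lt_neqAle c0 andbT eq_sym; apply/negP => /eqP c00.
  by move: h3; rewrite c00 !mul0r leNgt exprn_gt0.
move: h3; rewrite -ler_ln ?posrE ?exprn_gt0 ?mulr_gt0 ?powR_gt0//.
rewrite lnXn// !lnM ?posrE ?mulr_gt0 ?powR_gt0// !ln_powR => h3.
have h4 : ln (1 + Y * w) <= ln (1 + w) + ln J%:R + ln (a J).
  have aJp : 0 < a J by exact: lt_le_trans aJ.
  have w1p : 0 < 1 + w by rewrite addr_gt0.
  rewrite -addrA -(lnM Jp aJp) -(lnM w1p Y0) ler_ln ?posrE ?(mulr_gt0 w1p)//.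
  by rewrite -/Y mulrDl mul1r [w * Y]mulrC lerD2r.
have h5 : tau2 * ln (1 + Y * w) <= tau2 * (ln (1 + w) + ln J%:R + ln (a J)).
  exact: ler_wpM2l.
have h6 := x0P _ x0J.
rewrite mulrA ler_pdivlMr//; move: h3; rewrite -[ln 3 *+ J]mulr_natr.
move: h5 h6; lra.
Qed.

(** When a_j >= exp(al j) from J0 on, at most J0 + (ln X) / al coordinates are active, and 3^((ln X)
    / al) = X^((ln 3) / al). So the powers of 3 in the grid become a power of X that does not depend
    on s. *)
Lemma spt_exponent_growth (Bt al : R) (J0 : nat) :
  (forall s, Bsum b s <= Bt) -> 0 < al ->
  (forall j, (J0 <= j)%N -> (1 <= j)%N -> al <= ln (a j) / j%:R) ->
  spt_exponent omega a b Lam (Bt + ln 3 / al).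
Proof.
move=> BtP al0 alP; have wp := neg_ln_gt0.
have Bt0 : 0 <= Bt.
  by apply: le_trans (BtP 0%N); rewrite /Bsum big_geq.
have ln3 : 0 < ln 3 :> R by rewrite ln_gt0// ltr1n.
pose tau := Bt + ln 3 / al.
have tau0 : 0 <= tau by rewrite addr_ge0// divr_ge0// ltW.
have aJ j : (J0 <= j)%N -> (1 <= j)%N -> al * j%:R <= ln (a j).
  move=> jJ j1; have := alP j jJ j1; rewrite ler_pdivlMr// ltr0n//.
have a0 j : (1 <= j)%N -> 0 < a j by move=> j1; exact: lt_le_trans (a_ge1 j1).
pose u := omega `^ (2^-1 * al).
have u01 : 0 <= u < 1 by rewrite powR_ge0/= powR_lt1// mulr_gt0// invr_gt0.
pose D := 2 / (1 - omega `^ 2^-1).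
have D0 : 0 <= D.
  by rewrite divr_ge0// subr_ge0 ltW// powR_lt1// invr_gt0.
pose S := J0%:R + (1 - u)^-1.
(* For an error constant uniform in s the weak consequence a_j >= ln a_j >= al j is enough: it
   dominates the sum by a geometric series after J0 terms. *)
have SP s : \sum_(j < s) omega `^ (2^-1 * a j.+1) <= S.
  apply: (@le_trans _ _ (\sum_(j < s) ((j < J0)%N%:R + u ^+ j))).
    apply: ler_sum => j _; case: (ltnP j J0) => jJ.
      apply: (@le_trans _ _ 1); last first.
        by rewrite lerDl exprn_ge0//; case/andP: u01.
      rewrite -[leRHS](powRr0 omega) ger_powR// mulr_ge0 ?invr_ge0//.
      exact/ltW/a0.
    rewrite add0r -powR_mulrn ?powR_ge0// -powRrM ger_powR//.
    rewrite -mulrA ler_pM2l ?invr_gt0//.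
    apply: (@le_trans _ _ (ln (a j.+1))).
      apply: (le_trans _ (aJ j.+1 _ _)) => //; last exact: leqW.
      by rewrite ler_pM2l// ler_nat.
    by apply/ltW/ln_sublinear/a0.
  rewrite big_split /=; apply: lerD; last exact: sum_geometric_le.
  by rewrite -natr_sum ler_nat sum_ltn_le.
pose K := 2 * Num.sqrt (expR (D * S)).
have WK s : 2 * Num.sqrt (W s) <= K.
  rewrite ler_pM2l// ler_wsqrtr//.
  apply: (@le_trans _ _ (expR (D * \sum_(j < s) omega `^ (2^-1 * a j.+1)))).
    rewrite mulr_sumr expR_sum; apply: ler_prod => j _.
    rewrite expR_ge1Dx andbT addr_ge0// mulr_ge0// powR_ge0//.
  by rewrite ler_expR ler_wpM2l.
have K0 : 0 < K by rewrite mulr_gt0// sqrtr_gt0 expR_gt0.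
have cntP s X : 1 <= X -> (active_count a s X)%:R <= J0%:R + ln X / al.
  move=> X1; have lX : 0 <= ln X / al by rewrite divr_ge0 ?ln_ge0// ltW.
  have : (active_count a s X <= J0 + Num.truncn (ln X / al))%N.
    apply: leq_trans (leq_add (sum_ltn_le s J0) (sum_ltn_le s _)).
    rewrite -big_split /=; apply: leq_sum => j _.
    case: leP => //= aX; case: (ltnP j J0) => jJ //=.
    rewrite truncn_gt_nat ler_pdivlMr// mulrC.
    by rewrite (le_trans (aJ _ (leqW jJ) _))// ler_ln ?posrE ?a0 ?(lt_le_trans ltr01).
  rewrite -(ler_nat R) natrD => /le_trans; apply.
  by rewrite lerD2l truncn_le.
(* Chosen so that X = c0 (1 + L), with L = ln(1/eps), satisfies (X / 4) w >= (1 + |ln K|) (1 + L) >=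
   ln K + L, that is, K omega^(X/4) <= eps. *)
pose c0 := 1 + 4 * (1 + `|ln K|) / w.
have c01 : 1 <= c0.
  by rewrite lerDl divr_ge0 ?(ltW wp)// mulr_ge0// addr_ge0.
split=> //; exists (2 * 3 ^+ J0 * c0 `^ tau).
  by rewrite !mulr_ge0 ?exprn_ge0 ?powR_ge0.
move=> s eps s0 /andP[eps0 eps1].
pose L := ln eps^-1; have L0 : 0 <= L by rewrite ln_ge0// invf_ge1// ltW.
pose X := c0 * (1 + L).
have L1 : 1 <= 1 + L by rewrite lerDl.
have X1 : 1 <= X by rewrite -[leLHS]mulr1 ler_pM.
have Xp : 0 < X by exact: lt_le_trans X1.
pose Z := 3 ^+ J0 * X `^ tau.
have Z1 : 1 <= Z.
  rewrite -[leLHS]mulr1 ler_pM ?exprn_ege1 ?ler1n//.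
  by rewrite -[leLHS](powRr0 X) ler_powR.
have ZX : 3 ^+ active_count a s X * X `^ Bsum b s <= Z.
  rewrite /Z /tau addrC powRD ?(gt_eqF Xp) ?implybT// mulrA.
  apply: ler_pM; rewrite ?exprn_ge0 ?powR_ge0//; last by rewrite ler_powR.
  have -> : X `^ (ln 3 / al) = 3 `^ (ln X / al).
    by rewrite /powR !gt_eqF//; congr expR; ring.
  rewrite -!powR_mulrn// -powRD ?implybT//; last by rewrite pnatr_eq0 implybT.
  by rewrite ler_powR ?ler1n// cntP.
pose n := (Num.truncn Z).+1.
have nZ : Z <= n%:R by exact/ltW/truncnS_gt.
have nZ2 : n%:R <= 2 * Z.
  have /andP[h _] := truncn_itv (le_trans ler01 Z1).
  have -> : n%:R = (Num.truncn Z)%:R + 1 :> R by rewrite natr1.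
  by rewrite mulr_natl mulr2n; exact: lerD.
apply: (@le_trans _ _ (n%:R)%:E).
  apply: info_complexity_le.
  apply: (le_trans (min_error_grid_powR homega a_ge1 b_ge1 Lam X1 (le_trans ZX nZ))).
  rewrite lee_fin; apply: (@le_trans _ _ (K * omega `^ (X / 4))).
    by rewrite ler_wpM2r ?powR_ge0.
  have h1 : (1 + `|ln K|) * (1 + L) <= X / 4 * w.
    have -> : X / 4 * w = (1 + L) / 4 * w + (1 + `|ln K|) * (1 + L).
      by rewrite /X /c0; field; rewrite lt_eqF// ln_lt0.
    rewrite lerDr mulr_ge0 ?(ltW wp)// divr_ge0//.
    exact: le_trans L1.
  have h2 : ln K + L <= (1 + `|ln K|) * (1 + L).
    rewrite mulrDr mulr1 lerD//; first by rewrite ler_wpDl// ler_norm.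
    by rewrite ler_peMl// lerDl.
  have pw : 0 < omega `^ (X / 4) by exact: powR_gt0.
  have Kpw : 0 < K * omega `^ (X / 4) by exact: mulr_gt0.
  have : ln (K * omega `^ (X / 4)) <= ln eps; last by rewrite ler_ln.
  have -> : ln eps = - L by rewrite /L lnV ?posrE// opprK.
  rewrite lnM ?posrE// ln_powR -subr_ge0.
  have -> : - L - (ln K + X / 4 * ln omega) = X / 4 * w - (ln K + L) by ring.
  by rewrite subr_ge0 (le_trans h2).
rewrite lee_fin; apply: (le_trans nZ2).
by rewrite /Z /X powRM ?(le_trans ler01)// !mulrA.
Qed.

End Complexity.

(** * Weak tractability *)

Section WeakTractability.
Variables (R : realType) (omega : R) (a b : nat -> R).
Hypothesis homega : 0 < omega < 1.
Hypothesis a_ge1 : forall j, (1 <= j)%N -> 1 <= a j.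
Hypothesis b_ge1 : forall j, (1 <= j)%N -> 1 <= b j.
Variable Lam : info_class.

Local Notation e_min := (min_error omega a b Lam).
Local Notation info := (info_complexity omega a b Lam).
Local Notation W := (half_weight_sum omega a).
Local Notation w := (- ln omega).

Let w0 : 0 < omega. Proof. by case/andP: homega. Qed.
Let w01 : 0 < omega <= 1. Proof. by rewrite w0 ltW//; case/andP: homega. Qed.

Lemma log_ratio_lt (n s : nat) (eps y d : R) : (0 < n)%N -> 0 < y ->
  (info eps s <= n%:R%:E)%E -> ln n%:R < d * y -> 0 < d ->
  (`| log0 (info eps s) / y%:E | < d%:E)%E.
Proof.
move=> n0 y0 + nd d0.
have [->//|[k ->]] := info_complexity_value omega a b Lam eps s.
rewrite lee_fin ler_nat => kn; rewrite /log0 inver (gt_eqF y0).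
have [->|k0] := posnP k; first by rewrite eqxx mul0e abse0 lte_fin.
rewrite eqe pnatr_eq0 (gtn_eqF k0) lne_EFin; last by rewrite ltr0n.
have lk : 0 <= ln k%:R :> R by rewrite ln_ge0// ler1n.
rewrite -EFinM abse_EFin lte_fin ger0_norm; last by rewrite divr_ge0// ltW.
rewrite ltr_pdivrMr//; apply: le_lt_trans nd.
by rewrite ler_ln ?posrE ?ltr0n// ler_nat.
Qed.

Lemma log_ratio_gt (z eps y d : R) (s : nat) : 1 <= z -> 0 < y ->
  (z%:E <= info eps s)%E -> (`| log0 (info eps s) / y%:E | < d%:E)%E ->
  ln z < d * y.
Proof.
move=> z1 y0; have z0 : 0 < z by exact: lt_le_trans z1.
have [->|[k ->]] := info_complexity_value omega a b Lam eps s.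
  by rewrite /log0 /= inver (gt_eqF y0) gt0_mulye ?lte_fin ?invr_gt0.
rewrite lee_fin => zk; have k0 : (0 < k)%N.
  by rewrite -(@ltr_nat R); exact: lt_le_trans zk.
rewrite /log0 inver (gt_eqF y0) eqe pnatr_eq0 (gtn_eqF k0).
rewrite lne_EFin ?ltr0n// -EFinM abse_EFin lte_fin => h.
have := le_lt_trans (ler_norm _) h; rewrite ltr_pdivrMr//; apply: le_lt_trans.
by rewrite ler_ln ?posrE ?ltr0n.
Qed.

(** If all a_j <= A, the cube at accuracy omega^(s A) forces ln n >= s ln 3, while s + ln(1/eps) = s
    (1 + A w) with w = - ln omega. The ratio stays at least (ln 3) / (1 + A w) in every
    dimension. *)
Lemma WT_unbounded : WT omega a b Lam ->
  forall A : R, exists j, (1 <= j)%N /\ A < a j.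
Proof.
move=> wt A; apply/not_existsP => aA.
have {}aA j : (1 <= j)%N -> a j <= A.
  by move=> j1; rewrite leNgt; apply/negP => Aj; apply: (aA j).
have wp := neg_ln_gt0 homega.
have A1 : 1 <= A by exact: le_trans (a_ge1 (leqnn 1)) (aA _ (leqnn 1)).
have A0 : 0 < A by exact: lt_le_trans A1.
have ln3 : 0 < ln 3 :> R by rewrite ln_gt0// ltr1n.
have Aw : 0 < 1 + A * w by rewrite addr_gt0// mulr_gt0.
have [M MP] := wt (ln 3 / (1 + A * w)) (divr_gt0 ln3 Aw).
pose s := (Num.truncn `|M|).+1.
have s0 : 0 < s%:R :> R by rewrite ltr0n.
have Y0 : 0 < s%:R * A by exact: mulr_gt0.
have aY : \sum_(j < s) a j.+1 <= s%:R * A.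
  apply: (@le_trans _ _ (\sum_(j < s) A)).
    by apply: ler_sum => j _; exact: aA.
  by rewrite sumr_const card_ord mulr_natl.
have yE : s%:R + ln (omega `^ (s%:R * A))^-1 = s%:R * (1 + A * w).
  by rewrite ln_eps_powR mulrDr mulr1 mulrA.
have := MP s (omega `^ (s%:R * A)) isT (eps_powR homega Y0).
rewrite yE => /(_ _)
  /(log_ratio_gt _ _ (info_complexity_cube homega a_ge1 b_ge1 Lam Y0 aY)).
rewrite exprn_ege1 ?ler1n// mulr_gt0// => /(_ isT isT).
have -> : ln 3 / (1 + A * w) * (s%:R * (1 + A * w)) = ln (3 ^+ s) :> R.
  by rewrite lnXn// -[RHS]mulr_natr mulrCA divfK ?gt_eqF// mulrC.
rewrite ltxx => H.
suff : false by []; apply: H.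
apply: (@le_lt_trans _ _ `|M|); first exact: ler_norm.
apply: (lt_le_trans (truncnS_gt _)); rewrite ler_peMr ?(ltW s0)//.
by rewrite lerDl mulr_ge0 // ltW.
Qed.

(** Put y = s + ln(1/eps) and X = kap y. The logarithm of the number of lattice points splits into
    the Markov factor omega^(-tX), the coordinates with large a_j, and a constant plus ln y. Each
    part is made at most d y / 4, which leaves room for the strict inequality. *)
Lemma WT_growth :
  (forall A : R, exists J : nat, forall j, (J <= j)%N -> A <= a j) ->
  WT omega a b Lam.
Proof.
move=> a_infty d d0; have wp := neg_ln_gt0 homega.
have ln2 : 0 < ln 2 :> R by rewrite ln_gt0// ltr1n.
pose D := 2 / (1 - omega `^ 2^-1).
have D0 : 0 <= D.
  by rewrite divr_ge0// subr_ge0 ltW// powR_lt1// invr_gt0.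
have lnD : 0 <= ln (1 + D) by rewrite ln_ge0// lerDl.
(* Makes (X / 4) w equal to (ln 2 + ln(1 + D) + 1) y, which covers both ln(1/eps) and the logarithm
   of the error constant, itself at most ln(2 (1 + D)^s). *)
pose kap := 4 * (ln 2 + ln (1 + D) + 1) / w.
have k0 : 0 < kap by rewrite divr_gt0// mulr_gt0// ltr_pwDr// addr_ge0// ltW.
(* The number of points contains m^2, so the Markov factor contributes 2 t X w, which is now exactly
   d y / 4. *)
pose t := d / (8 * w * kap).
have t0 : 0 < t by apply: divr_gt0 => //; rewrite mulr_gt0// mulr_gt0.
pose Dt := 2 / (1 - omega `^ t).
have Dt0 : 0 <= Dt by rewrite divr_ge0// subr_ge0 ltW// powR_lt1.
have Dt1 : 0 < Dt + 1 by rewrite ltr_wpDl.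
(* From index J on, omega^(t a_j) <= eta, and these coordinates contribute at most 2 Dt eta s <= d s
   / 4. The order of choice matters: kap determines t, t determines Dt and with it eta and J, and x0
   comes last. *)
pose eta := d / (8 * (Dt + 1)).
have eta0 : 0 < eta by rewrite divr_gt0// mulr_gt0.
have [J JP] := a_infty (ln eta / (t * ln omega)).
have aJ j : (J <= j)%N -> omega `^ (t * a j) <= eta.
  move=> jJ; rewrite /powR gt_eqF// -[leRHS]lnK ?posrE// ler_expR.
  have := JP j jJ; rewrite ler_ndivrMr; first by rewrite mulrCA mulrA.
  by rewrite nmulr_llt0// ln_lt0//; case/andP: homega => ->.
have [x0 x01 x0P] := @affine_ln_le R (ln (2 * kap + 1) + 2 * (Dt * J%:R)) 1 (d / 4)
  (divr_gt0 d0 (ltr0n _ 4)) ler01.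
exists x0 => s eps s0 /andP[eps0 eps1]; set y := s%:R + _ => xy.
pose L := ln eps^-1; have L0 : 0 <= L by rewrite ln_ge0// invf_ge1// ltW.
have yL : y = s%:R + L by [].
have y0 : 0 < y by apply: lt_trans xy; exact: lt_le_trans x01.
have y1 : 1 <= y by apply: (le_trans x01); exact: ltW.
have s1 : 1 <= s%:R :> R by rewrite ler1n.
pose X := kap * y; have X0 : 0 < X by exact: mulr_gt0.
have [m [m0 mX em]] := min_error_lattice homega a_ge1 b_ge1 Lam s (ltW X0) t0.
have WD : W s <= (1 + D) ^+ s.
  rewrite -[s in leRHS]card_ord -prodr_const; apply: ler_prod => j _.
  rewrite -/D; apply/andP; split.
    by apply: addr_ge0 => //; apply: mulr_ge0 => //; exact: powR_ge0.
  rewrite lerD2l; apply: ler_piMr => //.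
  rewrite -[leRHS](powRr0 omega) ger_powR// mulr_ge0 ?invr_ge0//.
  exact: le_trans (a_ge1 _).
have W1 : 1 <= W s by exact: half_weight_sum_ge1.
have err : 2 * Num.sqrt (W s) * omega `^ (X / 4) <= eps.
  have q1 : Num.sqrt (W s) <= (1 + D) ^+ s.
    apply: le_trans WD; rewrite -[leRHS]sqr_sqrtr ?(le_trans ler01)//.
    by rewrite expr2 ler_peMr// -[leLHS]sqrtr1 ler_wsqrtr.
  have DD : 0 < 1 + D by rewrite ltr_pwDl.
  have p1 : 0 < 2 * (1 + D) ^+ s * omega `^ (X / 4).
    by rewrite !mulr_gt0 ?exprn_gt0 ?powR_gt0.
  apply: (@le_trans _ _ (2 * (1 + D) ^+ s * omega `^ (X / 4))).
    by rewrite ler_wpM2r ?powR_ge0// ler_pM2l.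
  rewrite -ler_ln ?posrE// !lnM ?posrE ?mulr_gt0 ?exprn_gt0 ?powR_gt0//.
  rewrite ln_powR lnXn// -[ln _ *+ s]mulr_natr.
  have -> : ln eps = - L by rewrite /L lnV ?posrE// opprK.
  have -> : X / 4 * ln omega = - ((ln 2 + ln (1 + D) + 1) * y).
    by rewrite /X /kap; field; rewrite lt_eqF// ln_lt0//; case/andP: homega => ->.
  rewrite yL -subr_ge0.
  have -> : - L - (ln 2 + ln (1 + D) * s%:R - (ln 2 + ln (1 + D) + 1) * (s%:R + L))
    = ln 2 * (s%:R - 1) + ln 2 * L + ln (1 + D) * L + s%:R by ring.
  by rewrite !addr_ge0// mulr_ge0 ?subr_ge0// ltW.
have infon := info_complexity_le (le_trans em (err : (_%:E <= eps%:E)%E)).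
apply: (log_ratio_lt _ y0 infon) => //.
have mp : 0 < m%:R :> R by rewrite ltr0n.
have m1 : 1 <= m%:R :> R by rewrite ler1n.
have lnm : ln m%:R <= t * X * w + Dt * (J%:R + eta * s%:R).
  have lnexp : m%:R <= expR (t * X * w + Dt * (J%:R + eta * s%:R)).
    apply: (le_trans mX); rewrite expRD; apply: ler_pM; rewrite ?powR_ge0//.
    - by apply: prodr_ge0 => j _; rewrite addr_ge0// mulr_ge0// powR_ge0.
    - by rewrite /powR gt_eqF// mulrN mulNr.
    apply: (@le_trans _ _ (expR (Dt * \sum_(j < s) omega `^ (t * a j.+1)))).
      rewrite mulr_sumr expR_sum; apply: ler_prod => j _.
      by rewrite expR_ge1Dx andbT addr_ge0// mulr_ge0// powR_ge0.
    rewrite ler_expR ler_wpM2l//.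
    apply: (@le_trans _ _ (\sum_(j < s) ((j < J)%N%:R + eta))); last first.
      rewrite big_split /= sumr_const card_ord -[eta *+ s]mulr_natr lerD2r.
      by rewrite -natr_sum ler_nat sum_ltn_le.
    apply: ler_sum => j _; case: (ltnP j J) => jJ.
      apply: (@le_trans _ _ 1); last by rewrite lerDl ltW.
      rewrite -[leRHS](powRr0 omega) ger_powR// mulr_ge0 ?(ltW t0)//.
      exact: le_trans (a_ge1 _).
    by rewrite add0r aJ// leqW.
  by rewrite -[leRHS]expRK ler_ln ?posrE ?expR_gt0.
have ln_n : ln ((2 * Num.truncn X * m ^ 2).+1)%:R <=
    ln (2 * kap + 1) + ln y + 2 * ln m%:R.
  have k1 : 0 < 2 * kap + 1 by rewrite addr_gt0// mulr_gt0.
  have -> : 2 * ln m%:R = ln (m%:R ^+ 2) :> R by rewrite lnXn// mulr_natl.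
  rewrite -lnM ?posrE// -lnM ?posrE ?exprn_gt0 ?mulr_gt0//.
  rewrite ler_ln ?posrE ?ltr0n// ?mulr_gt0 ?exprn_gt0//.
  rewrite -(natr1 (_ * _)%N) (natrM _ (2 * _)%N) natrX natrM.
  have m21 : 1 <= m%:R ^+ 2 :> R by rewrite exprn_ege1.
  apply: (@le_trans _ _ ((2 * X + 1) * m%:R ^+ 2)).
    rewrite [leRHS]mulrDl mul1r; apply: lerD => //.
    apply: ler_wpM2r; first by rewrite exprn_ge0.
    rewrite ler_pM2l//.
    by rewrite truncn_le ltW.
  apply: ler_wpM2r; first by rewrite exprn_ge0.
  by rewrite [leRHS]mulrDl mul1r mulrA lerD2l.
have e1 : 2 * (t * X * w) = d / 4 * y.
  by rewrite /t /X; field; rewrite gt_eqF//= lt_eqF// ln_lt0//; case/andP: homega => ->.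
have e2 : 2 * (Dt * (eta * s%:R)) <= d / 4 * y.
  have -> : 2 * (Dt * (eta * s%:R)) = d / 4 * s%:R * (Dt / (Dt + 1)).
    by rewrite /eta; field; rewrite gt_eqF.
  apply: (@le_trans _ _ (d / 4 * s%:R)).
    rewrite ler_piMr ?mulr_ge0 ?divr_ge0 ?(ltW d0)//.
    by rewrite ler_pdivrMr// mul1r lerDl.
  by rewrite ler_wpM2l ?divr_ge0 ?(ltW d0)// yL lerDl.
have e3 := x0P y (ltW xy).
have e4 : 0 < d * y by exact: mulr_gt0.
apply: (le_lt_trans ln_n); rewrite mul1r in e3.
apply: (@le_lt_trans _ _ (ln (2 * kap + 1) + ln y +
   2 * (t * X * w + Dt * (J%:R + eta * s%:R)))).
  by rewrite lerD2l ler_pM2l.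
have -> : ln (2 * kap + 1) + ln y + 2 * (t * X * w + Dt * (J%:R + eta * s%:R)) =
  (ln (2 * kap + 1) + 2 * (Dt * J%:R) + ln y) + 2 * (t * X * w) +
  2 * (Dt * (eta * s%:R)) by ring.
rewrite e1; apply: (@le_lt_trans _ _ (d / 4 * y + d / 4 * y + d / 4 * y)).
  by rewrite lerD// lerD.
have -> : d / 4 * y + d / 4 * y + d / 4 * y = d * y - d * y / 4 by field.
by rewrite gtrBl divr_gt0.
Qed.

End WeakTractability.

(** * The exponents *)

Section WeightSequences.
Variables (R : realType) (a b : nat -> R).
Hypothesis b_ge1 : forall j, (1 <= j)%N -> 1 <= b j.

Let bV_ge0 j : (1 <= j)%N -> 0 <= (b j)^-1.
Proof. by move=> j1; rewrite invr_ge0 (le_trans ler01)// b_ge1. Qed.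

Lemma Bsum_le_Btot s : ((Bsum b s)%:E <= Btot b)%E.
Proof.
rewrite /Bsum /Btot -sumEFin.
by apply: nneseries_lim_ge => j j1 _; rewrite lee_fin bV_ge0.
Qed.

Lemma Btot_le (p : R) : (forall s, (0 < s)%N -> Bsum b s <= p) ->
  (Btot b <= p%:E)%E.
Proof.
move=> Bp; have p0 : 0 <= p.
  by apply: le_trans (Bp 1%N isT); rewrite /Bsum big_nat1 bV_ge0.
apply: lime_le.
  by apply: is_cvg_nneseries => j j1 _; rewrite lee_fin bV_ge0.
(* The partial sums run over 1 <= j < N: they are empty for N = 0 and N = 1, and N = s + 2 gives
   [Bsum b s.+1]. *)
apply: nearW => -[|[|s]]; rewrite ?sumEFin lee_fin.
- by rewrite big_geq.
- by rewrite big_geq.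
- exact: Bp.
Qed.

Lemma Btot_gt0 : (0 < Btot b)%E.
Proof.
by apply: lt_le_trans (Bsum_le_Btot 1); rewrite lte_fin Bsum_gt0.
Qed.

Lemma Btot_fin : (Btot b < +oo)%E ->
  exists2 B : R, 0 < B & Btot b = B%:E /\ forall s, Bsum b s <= B.
Proof.
move=> Boo; have := Btot_gt0; have := Bsum_le_Btot.
case: (Btot b) Boo => [B|//|//] _ BB B0.
by exists B => //; split => // s; rewrite -lee_fin.
Qed.

Lemma alpha_starE : alpha_star a =
  ereal_sup (range (einfs (fun j => (ln (a j) / j%:R)%:E))).
Proof.
by rewrite /alpha_star limn_einf_lim; apply/cvg_lim => //; exact: cvg_einfs_sup.
Qed.

Lemma alpha_star_gt (al : R) : (al%:E < alpha_star a)%E ->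
  exists J0 : nat, forall j, (J0 <= j)%N -> al <= ln (a j) / j%:R.
Proof.
rewrite alpha_starE => /ereal_sup_gt[_ [J0 _ <-] alJ].
exists J0 => j Jj; rewrite -lee_fin; apply/ltW; apply: (lt_le_trans alJ).
by apply: ereal_inf_lbound; exists j.
Qed.

Lemma alpha_star_ge (c : R) (J0 : nat) :
  (forall j, (J0 <= j)%N -> c <= ln (a j) / j%:R) -> (c%:E <= alpha_star a)%E.
Proof.
move=> cJ; rewrite alpha_starE; apply: le_ereal_sup_tmp.
exists (einfs (fun j => (ln (a j) / j%:R)%:E) J0); first by exists J0.
by apply: le_ereal_inf_tmp => _ [j /= Jj <-]; rewrite lee_fin cJ.
Qed.

End WeightSequences.

(** * The tractability notions in terms of the weights *)

Section Equivalences.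
Variables (R : realType) (omega : R) (a b : nat -> R).
Hypothesis homega : 0 < omega < 1.
Hypothesis a_mono : forall j, (1 <= j)%N -> a j <= a j.+1.
Hypothesis a_ge1 : forall j, (1 <= j)%N -> 1 <= a j.
Hypothesis b_ge1 : forall j, (1 <= j)%N -> 1 <= b j.
Variable Lam : info_class.

Lemma EXP_holds : EXP omega a b Lam.
Proof.
have [|q [C [C1 H]]] := @exp_bound_exists R omega a b homega a_ge1 b_ge1 Lam
  (fun s => (Bsum b s)^-1).
  by move=> s s0; have B0 := Bsum_gt0 b_ge1 s0; rewrite invr_gt0 mulVf// gt_eqF.
by exists q, (fun s => (Bsum b s)^-1), C, C1.
Qed.

Lemma p_starE s : (1 <= s)%N -> p_star omega a b Lam s = ((Bsum b s)^-1)%:E.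
Proof.
move=> s0; have B0 := Bsum_gt0 b_ge1 s0; apply/eqP; rewrite eq_le; apply/andP; split.
  apply: ge_ereal_sup => _ [p [q [C [C1 H]]] <-]; rewrite lee_fin.
  rewrite -[leRHS]mul1r ler_pdivlMr//.
  exact: (exp_bound_exponent homega a_ge1 b_ge1 s0 H).
apply: ereal_sup_ubound; exists (fun s => (Bsum b s)^-1) => //.
apply: exp_bound_exists => // k k0; have Bk := Bsum_gt0 b_ge1 k0.
by rewrite invr_gt0 mulVf// gt_eqF.
Qed.

Lemma uexp_exponent_Btot (B : R) : 0 < B -> (forall s, Bsum b s <= B) ->
  uexp_exponent omega a b Lam B^-1.
Proof.
move=> B0 BB; split; first by rewrite invr_gt0.
apply: exp_bound_exists => // s s0; rewrite invr_gt0; split=> //.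
by rewrite mulrC ler_pdivrMr// mul1r.
Qed.

Lemma uexp_exponent_le (p : R) : uexp_exponent omega a b Lam p ->
  (Btot b <= (p^-1)%:E)%E.
Proof.
move=> [p0 [q [C [C1 H]]]]; apply: (Btot_le b_ge1) => s s0.
rewrite -[leRHS]mul1r ler_pdivlMr// mulrC.
exact: (exp_bound_exponent homega a_ge1 b_ge1 s0 H).
Qed.

Lemma UEXP_iff : UEXP omega a b Lam <-> (Btot b < +oo)%E.
Proof.
split=> [[p /uexp_exponent_le Bp]|]; first exact: le_lt_trans Bp (ltry _).
by move=> /(Btot_fin b_ge1)[B B0 [_ BB]]; exists B^-1; exact: uexp_exponent_Btot.
Qed.

Lemma p_star_unifE : (Btot b < +oo)%E -> p_star_unif omega a b Lam = (Btot b)^-1%E.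
Proof.
move=> /(Btot_fin b_ge1)[B B0 [BE BB]]; rewrite BE inver gt_eqF//.
apply/eqP; rewrite eq_le; apply/andP; split; last first.
  by apply: ereal_sup_ubound; exists B^-1 => //; exact: uexp_exponent_Btot.
apply: ge_ereal_sup => _ [p up <-]; have [p0 _] := up.
have := uexp_exponent_le up; rewrite BE !lee_fin => Bp.
by rewrite -[leLHS]invrK lef_pV2 ?posrE// invr_gt0.
Qed.

(** The conclusions involve only the exponent of 1 + ln(1/eps). They thus give the weight conditions
    for polynomial tractability and, with [tau1] equal to 0, the lower bound for the exponent of
    strong polynomial tractability. *)
Lemma PT_exponent_bounds (c tau1 tau2 : R) : 0 <= c -> 0 <= tau1 -> 0 <= tau2 ->
  (forall s eps, (0 < s)%N -> 0 < eps < 1 -> (info_complexity omega a b Lam eps s <=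
     (c * s%:R `^ tau1 * (1 + ln eps^-1) `^ tau2)%:E)%E) ->
  [/\ (Btot b <= tau2%:E)%E, 0 < tau2 &
      forall e, 0 < e -> (((ln 3 - e) / tau2)%:E <= alpha_star a)%E].
Proof.
move=> c0 t10 t20 H.
have BP s : (0 < s)%N -> Bsum b s <= tau2.
  move=> s0.
  apply: (@Bsum_le_exponent _ _ _ _ homega a_ge1 b_ge1 Lam s (c * s%:R `^ tau1) _ s0 t20).
  by move=> eps e01; exact: H.
have t2p : 0 < tau2 by apply: lt_le_trans (BP 1%N isT); exact: Bsum_gt0.
split=> //; first exact: Btot_le.
move=> e e0; have [J0 JP] := ln_weight_ge homega a_ge1 b_ge1 e0 c0 t10 t20 a_mono H.
apply: (@alpha_star_ge _ _ _ J0) => j Jj.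
by rewrite ler_pdivrMr// mulrC JP.
Qed.

Lemma PT_weights : PT omega a b Lam -> (Btot b < +oo)%E /\ (0 < alpha_star a)%E.
Proof.
move=> [c [tau1 [tau2 [c0 t10 t20 H]]]].
have [BP t2p alP] := PT_exponent_bounds c0 t10 t20 H.
have ln3 : 0 < ln 3 :> R by rewrite ln_gt0// ltr1n.
split; first exact: le_lt_trans BP (ltry _).
apply: lt_le_trans (alP (ln 3 / 2) _); last by rewrite divr_gt0.
by rewrite lte_fin divr_gt0//; lra.
Qed.

Lemma SPT_PT : SPT omega a b Lam -> PT omega a b Lam.
Proof.
move=> [tau [tau0 [c c0 H]]]; exists c, 0, tau; split=> // s eps s0 e01.
by rewrite powRr0 mulr1; exact: H.
Qed.

Lemma spt_exponent_weights (al : R) : (Btot b < +oo)%E -> 0 < al ->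
  (al%:E < alpha_star a)%E ->
  spt_exponent omega a b Lam (fine (Btot b) + ln 3 / al).
Proof.
move=> /(Btot_fin b_ge1)[B B0 [-> BB]] al0 /alpha_star_gt[J0 JP].
apply: (spt_exponent_growth homega a_ge1 b_ge1 Lam (J0 := J0)) => // j Jj _.
exact: JP.
Qed.

Lemma weights_SPT : (Btot b < +oo)%E -> (0 < alpha_star a)%E -> SPT omega a b Lam.
Proof.
move=> Boo al0; have [al [alp alla]] : exists al : R, 0 < al /\ (al%:E < alpha_star a)%E.
  case: (alpha_star a) al0 => [A||//]; last by exists 1; rewrite ltry.
  by rewrite lte_fin => A0; exists (A / 2); rewrite lte_fin; split; lra.
by exists (fine (Btot b) + ln 3 / al); exact: spt_exponent_weights.
Qed.

Lemma spt_exponent_ge (tau : R) : spt_exponent omega a b Lam tau ->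
  (Btot b <= tau%:E)%E /\ ((ln 3)%:E / alpha_star a <= tau%:E)%E.
Proof.
move=> [tau0 [c c0 H]].
have H' s eps : (0 < s)%N -> 0 < eps < 1 -> (info_complexity omega a b Lam eps s <=
    (c * s%:R `^ 0 * (1 + ln eps^-1) `^ tau)%:E)%E.
  by rewrite powRr0 mulr1; exact: H.
have [BP t2p alP] := PT_exponent_bounds c0 (lexx 0) tau0 H'; split=> //.
have ln3 : 0 < ln 3 :> R by rewrite ln_gt0// ltr1n.
have al0 : (0 < alpha_star a)%E.
  apply: lt_le_trans (alP (ln 3 / 2) _); last by rewrite divr_gt0.
  by rewrite lte_fin divr_gt0//; lra.
case: (alpha_star a) al0 alP => [A||//]; last first.
  by move=> _ _; rewrite invey mule0 lee_fin.
rewrite lte_fin => A0 alP; rewrite inver gt_eqF// -EFinM lee_fin ler_pdivrMr//.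
apply/ler_addgt0Pr => e e0; have := alP e e0.
by rewrite lee_fin ler_pdivrMr// lerBlDr mulrC.
Qed.

Lemma tau_star_ge :
  (maxe (Btot b) ((ln 3)%:E / alpha_star a) <= tau_star omega a b Lam)%E.
Proof.
apply: le_ereal_inf_tmp => _ [tau /spt_exponent_ge[Bt at_] <-].
by rewrite ge_max Bt at_.
Qed.

(** The exponents B + (ln 3) / al are available for al strictly below alpha*. With v = (ln 3) /
    alpha*, the choice al = (ln 3) / (v + e) treats finite and infinite alpha* alike and yields B +
    v + e for every e > 0. *)
Lemma tau_star_le : (Btot b < +oo)%E -> (0 < alpha_star a)%E ->
  (tau_star omega a b Lam <= Btot b + (ln 3)%:E / alpha_star a)%E.
Proof.
move=> Boo al0; have [B B0 [BE BB]] := Btot_fin b_ge1 Boo.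
have ln3 : 0 < ln 3 :> R by rewrite ln_gt0// ltr1n.
have [v v0 [vE vP]] : exists2 v : R, 0 <= v & ((ln 3)%:E / alpha_star a)%E = v%:E /\
    forall e, 0 < e -> ((ln 3 / (v + e))%:E < alpha_star a)%E.
  case: (alpha_star a) al0 => [A||//].
    rewrite lte_fin => A0; exists (ln 3 / A); first by rewrite divr_ge0 ?ltW.
    rewrite inver gt_eqF//; split=> // e e0.
    have vA : 0 < ln 3 / A by exact: divr_gt0.
    rewrite lte_fin ltr_pdivrMr ?addr_gt0// mulrDr mulrCA mulfV ?gt_eqF//.
    by rewrite mulr1 ltrDl mulr_gt0.
  by exists 0 => //; rewrite invey mule0; split => // e _; rewrite ltry.
rewrite vE BE -EFinD; apply/lee_addgt0Pr => e e0; rewrite -EFinD.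
have ve : 0 < v + e by rewrite ltr_wpDl.
apply: ereal_inf_lbound; exists (B + v + e) => //.
have -> : B + v + e = fine (Btot b) + ln 3 / (ln 3 / (v + e)).
  by rewrite BE /= invfM invrK mulrA mulfV ?gt_eqF// mul1r addrA.
by apply: spt_exponent_weights; rewrite ?divr_gt0//; exact: vP.
Qed.

(** Weak tractability by itself produces one weight above each bound; monotonicity of [a] carries
    the bound over to all later indices. *)
Lemma WT_iff : WT omega a b Lam <-> a j @[j --> \oo] --> +oo.
Proof.
split=> [wt|/cvgryPge aoo].
  apply/cvgryPge => A; have [J [J1 AJ]] := WT_unbounded homega a_ge1 b_ge1 wt A.
  exists J => // j /= Jj; apply: (le_trans (ltW AJ)).
  elim: j Jj => [|j IH]; first by rewrite leqn0 => /eqP->.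
  rewrite leq_eqVlt => /predU1P[->//|Jj]; apply: (le_trans (IH Jj)).
  by apply: a_mono; exact: leq_trans J1 Jj.
apply: WT_growth => // A; have [J _ JP] := aoo A.
by exists J => j Jj; exact: JP.
Qed.

End Equivalences.

Local Close Scope complex_scope.

Theorem theorem1 (R : realType) (omega : R) (a b : nat -> R)
    (homega : 0 < omega < 1)
    (ha1 : 1 <= a 1%N)
    (ha : forall j : nat, (1 <= j)%N -> a j <= a j.+1)
    (hb : forall j : nat, (1 <= j)%N -> 1 <= b j)
    (Lam : info_class) :
  let EXP := EXP omega a b Lam in
  let UEXP := UEXP omega a b Lam in
  let WT := WT omega a b Lam in
  let PT := PT omega a b Lam in
  let SPT := SPT omega a b Lam in
  let B := Btot b in
  let p_star := p_star omega a b Lam in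
  let p_star_unif := p_star_unif omega a b Lam in
  let tau_star := tau_star omega a b Lam in
  let alpha_star := alpha_star a in
  (* 1 *)
  [/\ EXP,
      forall s : nat, (1 <= s)%N -> p_star s = ((Bsum b s)^-1)%:E,
      WT <-> WT /\ EXP,
      PT <-> PT /\ EXP
    & SPT <-> SPT /\ EXP] /\
  (* 2 *)
  ((UEXP <-> (B < +oo)%E) /\
   ((B < +oo)%E ->
     [/\ p_star_unif = (B^-1)%E,
         WT <-> WT /\ UEXP,
         PT <-> PT /\ UEXP
       & SPT <-> SPT /\ UEXP])) /\
  (* 3 *)
  [/\ PT -> UEXP, SPT -> UEXP, PT <-> PT /\ UEXP & SPT <-> SPT /\ UEXP] /\
  (* 4 *)
  ((WT <-> a j @[j --> \oo] --> +oo) /\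
   (WT /\ UEXP <-> (B < +oo)%E /\ a j @[j --> \oo] --> +oo)) /\
  (* 5 *)
  [<-> PT; PT /\ EXP; PT /\ UEXP; SPT; SPT /\ EXP; SPT /\ UEXP] /\
  (* 6; in the extended reals (log 3)/+oo = 0 *)
  ((SPT /\ UEXP <-> (B < +oo)%E /\ (0 < alpha_star)%E) /\
   (SPT /\ UEXP ->
     [/\ (maxe B ((ln 3)%:E / alpha_star) <= tau_star)%E,
         (tau_star <= B + (ln 3)%:E / alpha_star)%E
       & (alpha_star = +oo)%E -> tau_star = B])).
Proof.
have a_ge1 j : (1 <= j)%N -> 1 <= a j.
  by case: j => // j _; elim: j => // j IH; apply: (le_trans IH); exact: ha.
have exp := EXP_holds homega a_ge1 hb Lam.
have uexpP := UEXP_iff homega a_ge1 hb Lam.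
have wtP := WT_iff homega ha a_ge1 hb Lam.
have ptW := @PT_weights R omega a b homega ha a_ge1 hb Lam.
have sptW := @weights_SPT R omega a b homega a_ge1 hb Lam.
have sptPT := @SPT_PT R omega a b Lam.
have ptUEXP : Defs.PT omega a b Lam -> Defs.UEXP omega a b Lam.
  by move=> /ptW[Boo _]; exact/uexpP.
have ptSPT : Defs.PT omega a b Lam -> Defs.SPT omega a b Lam.
  by move=> /ptW[Boo al0]; exact: sptW.
move=> EXP UEXP WT PT SPT B p_star p_star_unif tau_star alpha_star.
split.
  split; [exact: exp|exact: p_starE|by split=> [|[]]..].
split.
  split; first exact: uexpP.
  move=> Boo; have uexp : UEXP by exact/uexpP.
  split; [exact: p_star_unifE|by split=> [|[]]..].
split.
  split; [exact: ptUEXP|by move=> /sptPT/ptUEXP| |].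
    by split=> [pt|[]//]; split=> //; exact: ptUEXP.
  by split=> [spt|[]//]; split=> //; exact/ptUEXP/sptPT.
split.
  split; first exact: wtP.
  by split=> -[wt u]; split; [exact/uexpP|exact/wtP|exact/wtP|exact/uexpP].
split.
  (* The cycle closes because polynomial tractability forces the conditions on B and alpha*, and
     these in turn suffice for strong polynomial tractability. *)
  tfae.
  - by move=> pt; split.
  - by move=> [pt _]; split=> //; exact: ptUEXP.
  - by move=> [pt _]; exact: ptSPT.
  - by move=> spt; split.
  - by move=> [spt _]; split=> //; exact/ptUEXP/sptPT.
  - by move=> [spt _]; exact: sptPT.
have sptP : SPT /\ UEXP <-> (B < +oo)%E /\ (0 < alpha_star)%E.
  split=> [[/sptPT/ptW//]|[Boo al0]].
  by split; [exact: sptW|exact/uexpP].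
split; first exact: sptP.
move=> /sptP[Boo al0].
have lo := @tau_star_ge R omega a b homega ha a_ge1 hb Lam.
have up := @tau_star_le R omega a b homega a_ge1 hb Lam Boo al0.
split; [exact: lo|exact: up|move=> aoo].
move: lo up; rewrite -/alpha_star aoo invey mule0 adde0 ge_max => /andP[lo _] up.
by apply/eqP; rewrite eq_le up lo.
Qed.
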